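(* Let $n \ge 2$ and let $p, q \in [1,\infty]$ with $p^{-1} + q^{-1} < 1$. There is a constant $C(n,p,q)$, depending only on $n$, $p$ and $q$, such that the following holds. Let $\Omega \subset \mathbb{R}^n$ be open and bounded, and let $\varphi \in W^{1,n}_0(\Omega)$ satisfy $$|\nabla \varphi(x)|^n \le K(x)\bigl(\langle \nabla \varphi(x), \xi(x)\rangle + A(x)\bigr) \qquad \text{for a.e. } x \in \Omega,$$ where $K, A \colon \Omega \to [0, \infty)$ are measurable functions and $\xi \in L^{n/(n-1)}(\Omega, \mathbb{R}^n)$ with $\operatorname{div} \xi = 0$ weakly. If $K \in L^p(\Omega)$ and $A \in L^q(\Omega)$, then $$\|\varphi\|_{L^\infty(\Omega)}^n \le C(n,p,q)\, \|K\|_{L^p(\Omega)} \|A\|_{L^q(\Omega)} [m_n(\Omega)]^{1 - p^{-1} - q^{-1}}.$$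
   Context: $m_n$ is $n$-dimensional Lebesgue measure; $\infty^{-1} = 0$. $W^{1,n}_0(\Omega)$ is the closure of $C_c^\infty(\Omega)$ in $W^{1,n}(\Omega)$ (real-valued functions). $\operatorname{div}\xi = 0$ weakly means $\int_\Omega \langle \xi, \nabla \eta\rangle \, dm_n = 0$ for all $\eta \in C_c^\infty(\Omega)$. *)

(* Defs.v *)
From HB Require Import structures.
From mathcomp Require Import all_boot all_order all_algebra.
From mathcomp Require Import all_classical all_reals all_analysis.
Set Implicit Arguments.
Unset Strict Implicit.
Unset Printing Implicit Defensive.
Import Order.TTheory GRing.Theory Num.Theory.
Import numFieldNormedType.Exports.
Local Open Scope classical_set_scope.
Local Open Scope ring_scope.

(* Lebesgue measure is first built on the Borel sets of the alias [borel_rV], by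
   iterated products; 'rV[R]_n itself then carries its completion, so that a set
   (resp. function) on 'rV[R]_n is [measurable] (resp. [measurable_fun]) exactly
   when it is Lebesgue measurable. *)
Definition borel_rV (R : realType) (n : nat) : Type := 'rV[R]_n.

HB.instance Definition _ (R : realType) n :=
  Pointed.copy (borel_rV R n) 'rV[R]_n.

Definition borel_rV_display : measure_display.
Proof. exact: default_measure_display. Qed.

Section borel_rV.
Context (R : realType) (n : nat).

Definition coord_rV (i : 'I_n) (x : borel_rV R n) : measurableTypeR R :=
  (x : 'rV[R]_n) ord0 i.

Let borel := g_sigma_preimage coord_rV.

Let borel0 : borel set0. Proof. exact: sigma_algebra0. Qed.

Let borelC A : borel A -> borel (~` A). Proof. exact: sigma_algebraC. Qed.

Let borel_bigcup (F : (set (borel_rV R n))^nat) :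
  (forall i, borel (F i)) -> borel (\bigcup_i (F i)).
Proof. exact: sigma_algebra_bigcup. Qed.

HB.instance Definition _ := @isMeasurable.Build borel_rV_display
  (borel_rV R n) borel borel0 borelC borel_bigcup.

Lemma measurable_coord_rV i : measurable_fun setT (coord_rV i).
Proof.
move=> _ Y mY; rewrite setTI; apply: sub_sigma_algebra => /=.
rewrite -bigcup_seq/=; exists i => /=; first by rewrite mem_index_enum.
by exists Y => //; rewrite setTI.
Qed.

Lemma measurable_fun_rV d (T : measurableType d) (f : T -> borel_rV R n) :
  (forall i, measurable_fun setT (coord_rV i \o f)) -> measurable_fun setT f.
Proof.
move=> mf; apply: measurability; first by reflexivity.
move=> _ [B + <-]; rewrite setTI -bigcup_seq/= => -[i _ [A mA <-]].
by rewrite setTI -comp_preimage -[X in measurable X]setTI; exact: mf.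
Qed.

End borel_rV.

Section borel_lebesgue.
Context (R : realType).

Definition cons_rV n (p : measurableTypeR R * borel_rV R n) :
    borel_rV R n.+1 :=
  \row_(i < n.+1) if unlift ord0 i is Some j then (p.2 : 'rV[R]_n) ord0 j
                  else p.1.

Definition uncons_rV n (x : borel_rV R n.+1) :
    measurableTypeR R * borel_rV R n :=
  ((x : 'rV[R]_n.+1) ord0 ord0,
   (\row_(j < n) (x : 'rV[R]_n.+1) ord0 (lift ord0 j)) : borel_rV R n).

Lemma cons_rVK n : cancel (@cons_rV n) (@uncons_rV n).
Proof.
case=> a x; rewrite /uncons_rV /cons_rV mxE unlift_none; congr (_, _).
by apply/rowP => j; rewrite !mxE liftK.
Qed.

Lemma uncons_rVK n : cancel (@uncons_rV n) (@cons_rV n).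
Proof.
move=> x; apply/rowP => i; rewrite mxE.
by case: unliftP => [j ->|->] //=; rewrite mxE.
Qed.

Lemma measurable_cons_rV n : measurable_fun setT (@cons_rV n).
Proof.
apply: measurable_fun_rV => i; case: (unliftP ord0 i) => [j ->|->].
- rewrite (_ : _ \o _ = @coord_rV R n j \o snd).
    by apply: measurableT_comp => //; exact: measurable_coord_rV.
  by apply/funext => p; rewrite /= /coord_rV /= mxE liftK.
- rewrite (_ : _ \o _ = fst)//.
  by apply/funext => p; rewrite /= /coord_rV /= mxE unlift_none.
Qed.

Lemma measurable_uncons_rV n : measurable_fun setT (@uncons_rV n).
Proof.
apply/measurable_fun_pairP; split; first exact: (measurable_coord_rV ord0).
apply: measurable_fun_rV => j.
rewrite (_ : _ \o _ = @coord_rV R n.+1 (lift ord0 j)).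
  exact: measurable_coord_rV.
by apply/funext => x; rewrite /= /coord_rV /= mxE.
Qed.

HB.instance Definition _ n :=
  isMeasurableFun.Build _ _ _ _ (@cons_rV n) (@measurable_cons_rV n).

Section step.
Context n (mu : {sigma_finite_measure set (borel_rV R n) -> \bar R}).

Definition lebesgue_step := pushforward (lebesgue_measure \x mu)%E (@cons_rV n).

Let step0 : lebesgue_step set0 = 0%E. Proof. exact: measure0. Qed.

Let step_ge0 A : (0 <= lebesgue_step A)%E. Proof. exact: measure_ge0. Qed.

Let step_sigma_additive : semi_sigma_additive lebesgue_step.
Proof. exact: measure_semi_sigma_additive. Qed.

HB.instance Definition _ := isMeasure.Build _ _ _ lebesgue_step
  step0 step_ge0 step_sigma_additive.

Let step_sigma_finite : sigma_finite setT lebesgue_step.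
Proof.
have /sigma_finiteP[F [TF ndF Foo]] :=
  sigma_finiteT (@lebesgue_measure R : {sigma_finite_measure set _ -> \bar R}).
have /sigma_finiteP[G [TG ndG Goo]] := sigma_finiteT mu.
exists (fun k => @uncons_rV n @^-1` (F k `*` G k)).
  rewrite -preimage_bigcup; apply/esym; rewrite -[RHS](preimage_setT (@uncons_rV n)).
  congr (_ @^-1` _); apply/seteqP; split => // -[x y] _.
  have [i _ Fix] : (\bigcup_i F i) x by rewrite -TF.
  have [j _ Gjy] : (\bigcup_i G i) y by rewrite -TG.
  exists (maxn i j) => //; split => /=.
    by move: Fix; apply/subsetPset/ndF/leq_maxl.
  by move: Gjy; apply/subsetPset/ndG/leq_maxr.
move=> k; have [mF Fk] := Foo k; have [mG Gk] := Goo k; split.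
  rewrite -[X in measurable X]setTI.
  by apply: measurable_uncons_rV => //; exact: measurableX.
rewrite /lebesgue_step /pushforward -comp_preimage.
rewrite (_ : _ \o _ = id); last by apply/funext => p; exact: cons_rVK.
rewrite preimage_id product_measure1E// lte_mul_pinfty// ge0_fin_numE//.
Qed.

HB.instance Definition _ := Measure_isSigmaFinite.Build _ _ _ lebesgue_step
  step_sigma_finite.

End step.

Fixpoint borel_lebesgue n :
    {sigma_finite_measure set (borel_rV R n) -> \bar R} :=
  if n is m.+1 then lebesgue_step (borel_lebesgue m) else \d_ ((0 : 'rV[R]_0) : borel_rV R 0).

End borel_lebesgue.

(* This determines [borel_lebesgue R n] as the usual Lebesgue measure. *)
Lemma borel_lebesgue_box (R : realType) n (A : 'I_n -> set (measurableTypeR R)) :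
  (forall i, measurable (A i)) ->
  borel_lebesgue R n [set x | forall i, A i (coord_rV i x)] =
  (\prod_(i < n) lebesgue_measure (A i))%E.
Proof.
elim: n A => [|n IH] A mA.
  by rewrite big_ord0 /= diracE mem_set// => -[].
have mB : measurable
    [set x : borel_rV R n | forall i, A (lift ord0 i) (coord_rV i x)].
  rewrite (_ : mkset _ =
      \bigcap_(i in [set: 'I_n]) (@coord_rV R n i @^-1` A (lift ord0 i))).
    apply: fin_bigcap_measurable => // i _.
    by rewrite -[X in measurable X]setTI; exact: measurable_coord_rV.
  by apply/seteqP; split => [x h i _|x h i]; exact: h.
rewrite big_ord_recl -(IH (fun i => A (lift ord0 i)))// -product_measure1E//.
rewrite /= /lebesgue_step /pushforward; congr (_ _).
apply/seteqP; split => [[a x] /= h|[a x] /= [h0 h] i].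
  split; first by have := h ord0; rewrite /coord_rV mxE unlift_none.
  by move=> j; have := h (lift ord0 j); rewrite /coord_rV mxE liftK.
rewrite /coord_rV mxE.
by case: unliftP => [j ->|->] //; exact: h.
Qed.

HB.instance Definition _ (R : realType) n :=
  Measurable.copy 'rV[R]_n (caratheodory_type ((borel_lebesgue R n)^*)%mu).

Definition lebesgue_rV (R : realType) n : {measure set 'rV[R]_n -> \bar R} :=
  @completed_measure_extension _ _ _ (borel_lebesgue R n).

Section sobolev.
Context (R : realType) (n : nat).
Implicit Types (Omega : set 'rV[R]_n) (p : \bar R).
Implicit Types (u f : 'rV[R]_n -> R) (F : 'rV[R]_n -> 'rV[R]_n).

Local Notation mu := (lebesgue_rV R n).

Definition dotv (x y : 'rV[R]_n) : R := \sum_i x ord0 i * y ord0 i.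

(* The library norm [`|x|] on row vectors is the sup norm. *)
Definition euclid_norm (x : 'rV[R]_n) : R := Num.sqrt (dotv x x).

Definition partial (i : 'I_n) f : 'rV[R]_n -> R :=
  fun x => 'D_(delta_mx ord0 i) f x.

Definition gradient f : 'rV[R]_n -> 'rV[R]_n := fun x => \row_i partial i f x.

Definition smooth f : Prop := forall s : seq 'I_n,
  continuous (foldr partial f s) /\
  forall i x, derivable (foldr partial f s) x (delta_mx ord0 i).

(* C_c^oo(Omega), each function being extended by 0 outside Omega *)
Definition test_function Omega f : Prop :=
  [/\ smooth f, compact (closure [set x | f x != 0]) &
      closure [set x | f x != 0] `<=` Omega].

(* Functions on Omega are total functions whose values outside Omega are
   irrelevant; [f \_ Omega] replaces those values by 0. *)
Definition Lp_norm Omega p f : \bar R := 'N[mu]_p[EFin \o (f \_ Omega)].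

Definition in_Lp Omega p f : Prop := f \_ Omega \in Lfun mu p.

Definition in_Lp_vec Omega p F : Prop :=
  forall i, in_Lp Omega p (fun x => F x ord0 i).

Definition locally_Lebesgue_integrable Omega f : Prop :=
  forall D, compact D -> D `<=` Omega -> mu.-integrable D (EFin \o f).

Definition weak_gradient Omega u F : Prop :=
  [/\ locally_Lebesgue_integrable Omega u,
      forall i, locally_Lebesgue_integrable Omega (fun x => F x ord0 i) &
      forall eta, test_function Omega eta -> forall i,
        \int[mu]_(x in Omega) (u x * partial i eta x) =
        - \int[mu]_(x in Omega) (F x ord0 i * eta x)].

Definition weakly_div_free Omega F : Prop :=
  forall eta, test_function Omega eta ->
    \int[mu]_(x in Omega) (dotv (F x) (gradient eta x)) = 0.

Definition W1p Omega p u : Prop :=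
  in_Lp Omega p u /\ exists2 F, weak_gradient Omega u F & in_Lp_vec Omega p F.

(* The W^{1,p}(Omega) norm of a function u with weak gradient F *)
Definition W1p_norm Omega p u F : \bar R :=
  (Lp_norm Omega p u + Lp_norm Omega p (euclid_norm \o F))%E.

Definition W1p0 Omega p u : Prop :=
  W1p Omega p u /\
  forall e : R, 0 < e -> exists2 eta, test_function Omega eta &
    exists2 F, weak_gradient Omega (u \- eta) F &
      (W1p_norm Omega p (u \- eta)%R F < e%:E)%E.

End sobolev.

(* Main.v *)
From HB Require Import structures.
From mathcomp Require Import all_boot all_order all_algebra.
From mathcomp Require Import all_classical all_reals all_analysis.
From mathcomp Require Import measurable_realfun ess_sup_inf ring lra.
Require Import Defs.
Set Implicit Arguments.
Unset Strict Implicit.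
Unset Printing Implicit Defensive.
Import Order.TTheory GRing.Theory Num.Theory.
Import numFieldNormedType.Exports.
Local Open Scope classical_set_scope.
Local Open Scope ring_scope.

(** The estimate is proved by testing div xi = 0 with a function of phi and then
    following the measures of the superlevel sets {s < phi}.

    Take heights 0 <= s < t, let g climb linearly from 0 at s to 1 at t, and write
    U = {s < phi}, theta = 1/p + 1/q. A primitive of g composed with phi is
    admissible in div xi = 0, so the integral of g(phi) <grad phi, xi> vanishes.
    The distortion inequality |grad phi|^n <= K (<grad phi, xi> + A) gives
    |grad phi| <= l K + m (<grad phi, xi> + A) + v whenever l m v^(n-2) = 1, an
    inequality in which <grad phi, xi> enters linearly; multiplied by g(phi) and
    integrated it leaves only
      l int_U K + m int_U A + v |U|.
    With Holder's inequality for K and A on U and the best weights l, m, v this is at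
    most a constant times (|K|_p |A|_q |U|^(n - theta))^(1/n). On the other side, the
    Gagliardo-Nirenberg-Sobolev inequality for g(phi) |grad phi| bounds it from below
    by a multiple of (t - s) |{t <= phi}|^((n-1)/n). Hence ([distribution_decay])
      (t - s)^n |{t < phi}|^(n-1) <= C |K|_p |A|_q |{s < phi}|^(n-1) |{s < phi}|^(1 - theta),
    and as 1 - theta > 0, Stampacchia's iteration along the heights d (1 - 2^-j)
    ([stampacchia_iteration]) shows that {d < phi} is null as soon as d^n exceeds a
    multiple of |K|_p |A|_q |Omega|^(1 - theta). The data (- phi, - xi, K, A) satisfy
    the same hypotheses, which bounds |phi|.

    Since phi is only a limit of test functions, the integral inequality is derived
    for a test function eta close to phi, with grad phi = F + grad eta and F small in
    L^n ([level_estimate]). Three ingredients make this possible.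

    - g(eta) is Lipschitz but not smooth. The absolute value is a uniform limit of
      polynomials on bounded intervals, so a function f orthogonal to all powers of a
      bounded u is orthogonal to every ramp of u ([moments_ramp]), and letting the
      ramps steepen, has integral 0 over every {a < u} ([moments_ray]). With
      f = <xi, grad eta> and u = eta, whose powers are test functions, this gives
      int g(eta) <xi, grad eta> = 0 ([div_free_ramp]).
    - The given weak gradient of phi must agree with F + grad eta where eta is not 0
      ([weak_gradient_test]). Their difference times eta is orthogonal to all
      polynomials in the coordinates, because eta times a polynomial is a test
      function; by [moments_ray] its integral over each octant vanishes, and octants
      generate the Borel sets ([vanishing_moments_ae0]).
    - The Sobolev inequality for eta follows from the fundamental theorem of calculus
      on lines parallel to the axes ([line_growth]) combined with a
      Loomis-Whitney inequality ([loomis_whitney], [test_function_sobolev]). *)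

(** * Bounded functions and vanishing moments *)

(** The iteration q + (x^2 - q^2)/2, whose fixed points satisfy q^2 = x^2; started at 0
    it increases to |x| on [-1, 1]. *)
Fixpoint abs_poly (R : realType) (k : nat) : {poly R} :=
  if k is j.+1 then abs_poly R j + 2^-1 *: ('X^2 - abs_poly R j ^+ 2) else 0.

(** Passing from q to q + (x^2 - q^2)/2 multiplies the error |x| - q by
    1 - (|x| + q)/2, which is at most 1 - |x|/2. The last clause expresses the resulting
    rate without dividing by |x|, which may be 0. *)
Lemma abs_poly_bounds (R : realType) (k : nat) (x : R) : `|x| <= 1 ->
  [/\ 0 <= (abs_poly R k).[x], (abs_poly R k).[x] <= `|x| &
      (`|x| - (abs_poly R k).[x]) * (2 + k%:R * `|x|) <= 2 * `|x|].
Proof.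
move=> x1; elim: k => [|k [q0 qx qk]] /=.
  by rewrite horner0; split => //; lra.
rewrite !hornerE/= -(real_normK (num_real x)).
move: q0 qx qk; set q := (abs_poly R k).[x]; set a : R := `|x| in x1 *.
have a0 : 0 <= a by exact: normr_ge0.
move=> q0 qx qk; have k0 : 0 <= k%:R :> R by [].
split.
- nra.
- nra.
rewrite -[k.+1%:R]natr1.
have -> : a - (q + 2^-1 * (a ^+ 2 - q ^+ 2)) = (a - q) * (1 - (a + q) / 2) by field.
have d0 : 0 <= a - q by lra.
apply: le_trans qk; rewrite -mulrA ler_wpM2l// mulrDl mul1r.
have ka0 : 0 <= k%:R * a by exact: mulr_ge0.
have := mulr_ge0 (addr_ge0 a0 q0) (addr_ge0 ka0 a0).
by nra.
Qed.

Lemma abs_poly_cvg (R : realType) (k : nat) (x : R) : `|x| <= 1 ->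
  `| `|x| - (abs_poly R k.+1).[x]| <= 2 / k.+1%:R.
Proof.
move=> x1; have [q0 qx] := abs_poly_bounds k.+1 x1.
move: q0 qx; set q := (abs_poly R k.+1).[x]; set a : R := `|x| in x1 *.
move=> q0 qx; have k0 : 0 < k.+1%:R :> R by [].
rewrite ger0_norm ?subr_ge0// ler_pdivlMr//.
have : 0 <= a by exact: normr_ge0.
rewrite le_eqVlt => /predU1P[a0 _|a0 H]; first by move: q0 qx k0; rewrite -a0; nra.
have H2 : ((a - q) * k.+1%:R) * a <= 2 * a by nra.
by rewrite ler_pM2r in H2.
Qed.

(** The piecewise linear function that is 0 below s, 1 above t and affine in between. It is
    written with absolute values so that approximating |.| by polynomials suffices to
    approximate it. *)
Definition ramp (R : realType) (s t y : R) : R :=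
  (`|y - s| - `|y - t| + (t - s)) / (2 * (t - s)).

Section ramp.
Context (R : realType) (s t : R).

Lemma ramp_low y : s < t -> y <= s -> ramp s t y = 0.
Proof.
move=> st ys; have ys0 : y - s <= 0 by lra.
have yt0 : y - t <= 0 by lra.
by rewrite /ramp !ler0_norm// (_ : _ + _ = 0) ?mul0r//; ring.
Qed.

Lemma ramp_high y : s < t -> t <= y -> ramp s t y = 1.
Proof.
move=> st ty; have ys0 : 0 <= y - s by lra.
have yt0 : 0 <= y - t by lra.
rewrite /ramp !ger0_norm//; field; apply: lt0r_neq0; lra.
Qed.

Lemma ramp_mid y : s < t -> s <= y -> y <= t -> ramp s t y = (y - s) / (t - s).
Proof.
move=> st sy yt; have ys0 : 0 <= y - s by lra.
have yt0 : y - t <= 0 by lra.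
rewrite /ramp ger0_norm// ler0_norm//; field; apply: lt0r_neq0; lra.
Qed.

Lemma ramp01 y : s < t -> 0 <= ramp s t y <= 1.
Proof.
move=> st; have [ys|sy] := leP y s; first by rewrite ramp_low// lexx ler01.
have [ty|yt] := leP t y; first by rewrite ramp_high// lexx ler01.
rewrite ramp_mid ?(ltW sy) ?(ltW yt)//; apply/andP; split.
  by apply: divr_ge0; lra.
by rewrite ler_pdivrMr; lra.
Qed.

Lemma ramp_ge0 y : s < t -> 0 <= ramp s t y. Proof. by move=> st; have /andP[] := ramp01 y st. Qed.
Lemma ramp_le1 y : s < t -> ramp s t y <= 1. Proof. by move=> st; have /andP[] := ramp01 y st. Qed.

Lemma measurable_ramp d (T : measurableType d) (D : set T) (u : T -> R) :
  measurable_fun D u -> measurable_fun D (fun x => ramp s t (u x)).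
Proof.
move=> mu; apply: measurable_funM => //; apply: measurable_funD => //.
by apply: measurable_funB; apply: measurableT_comp => //; exact: measurable_funB.
Qed.

End ramp.

Section moments.
Context d (T : measurableType d) (R : realType).
Variable mu : {measure set T -> \bar R}.
Implicit Types (D : set T) (f g u : T -> R).

Lemma integrableD_fun D f g : measurable D ->
  mu.-integrable D (EFin \o f) -> mu.-integrable D (EFin \o g) ->
  mu.-integrable D (EFin \o (fun x => f x + g x)).
Proof. by move=> mD fi gi; rewrite -[_ \o _]/((EFin \o f) \+ (EFin \o g))%E; exact: integrableD. Qed.

Lemma integrableB_fun D f g : measurable D ->
  mu.-integrable D (EFin \o f) -> mu.-integrable D (EFin \o g) ->
  mu.-integrable D (EFin \o (fun x => f x - g x)).
Proof. by move=> mD fi gi; rewrite -[_ \o _]/((EFin \o f) \- (EFin \o g))%E; exact: integrableB. Qed.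

Lemma integrableZl_fun D f c : measurable D ->
  mu.-integrable D (EFin \o f) -> mu.-integrable D (EFin \o (fun x => c * f x)).
Proof. by move=> mD fi; exact: (integrableZl mD c fi). Qed.

Lemma integrable_sum_fun D (I : finType) (F : I -> T -> R) : measurable D ->
  (forall i, mu.-integrable D (EFin \o F i)) ->
  mu.-integrable D (EFin \o (fun x => \sum_i F i x)).
Proof.
move=> mD Fi; elim: (index_enum I) => [|i r IH].
  by under eq_fun do rewrite big_nil; exact: integrable0.
by under eq_fun do rewrite big_cons; exact: integrableD_fun.
Qed.

Lemma integrable_Mbounded D f g (M : R) : measurable D ->
  mu.-integrable D (EFin \o f) -> measurable_fun D g ->
  (forall x, D x -> `|g x| <= M) ->
  mu.-integrable D (EFin \o (fun x => f x * g x)).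
Proof.
move=> mD fi mg gM; apply: (integrableMl mD fi mg).
exists M; split; first exact: num_real.
by move=> y My x Dx; exact: le_trans (gM _ Dx) (ltW My).
Qed.

Variables (D : set T) (mD : measurable D).
Variables (f u : T -> R) (M : R).
Hypothesis fi : mu.-integrable D (EFin \o f).
Hypothesis umeas : measurable_fun D u.
Hypothesis uM : forall x, D x -> `|u x| <= M.
Hypothesis moment0 : forall k, \int[mu]_(x in D) (f x * u x ^+ k) = 0.

Let integrable_moment k : mu.-integrable D (EFin \o (fun x => f x * u x ^+ k)).
Proof.
apply: (@integrable_Mbounded _ _ _ (M ^+ k)) => //.
  exact: measurable_funX.
by move=> x Dx; rewrite normrX lerXn2r// ?nnegrE//; [exact: le_trans (uM Dx)|exact: uM].
Qed.

Let moment_poly (p : {poly R}) (k : nat) :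
  mu.-integrable D (EFin \o (fun x => f x * u x ^+ k * p.[u x])) /\
  \int[mu]_(x in D) (f x * u x ^+ k * p.[u x]) = 0.
Proof.
elim/poly_ind: p k => [|p c IH] k.
  under eq_fun do rewrite horner0 mulr0; split; first exact: integrable0.
  by rewrite Rintegral_cst// mul0r.
have E x : f x * u x ^+ k * (p * 'X + c%:P).[u x] =
    f x * u x ^+ k.+1 * p.[u x] + c * (f x * u x ^+ k).
  by rewrite hornerD hornerM hornerX hornerC exprS; ring.
have [ip p0] := IH k.+1.
have ic := integrableZl_fun c mD (integrable_moment k).
split.
  by under eq_fun do rewrite E; exact: integrableD_fun.
under eq_Rintegral do rewrite E.
by rewrite RintegralD// p0 RintegralZl// moment0 mulr0 addr0.
Qed.

(** After an affine change of variable u takes values in [-1, 1], where |.| is a uniform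
    limit of polynomials, and f is orthogonal to every polynomial in u. *)
Lemma moments_abs (a : R) : \int[mu]_(x in D) (f x * `|u x - a|) = 0.
Proof.
set N : R := `|M| + `|a| + 1.
have N0 : 0 < N by rewrite ltr_wpDl// addr_ge0.
pose v x := (u x - a) / N.
have v1 x : D x -> `|v x| <= 1.
  move=> Dx; rewrite normrM normfV (gtr0_norm N0) ler_pdivrMr// mul1r.
  rewrite (le_trans (ler_normB _ _))// /N.
  by have := uM Dx; have := ler_norm M; lra.
have mv : measurable_fun D v.
  by apply: measurable_funM => //; exact: measurable_funB.
have q0 (p : {poly R}) : mu.-integrable D (EFin \o (fun x => f x * p.[v x])) /\
    \int[mu]_(x in D) (f x * p.[v x]) = 0.
  have [] := moment_poly (p \Po (N^-1 *: ('X - a%:P))) 0.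
  have E x : f x * u x ^+ 0 * (p \Po (N^-1 *: ('X - a%:P))).[u x] = f x * p.[v x].
    by rewrite expr0 mulr1 horner_comp hornerZ hornerD hornerN hornerX hornerC [_^-1 * _]mulrC.
  by rewrite (_ : (fun x => _) = (fun x => f x * p.[v x])); last exact/funext.
suff v0 : \int[mu]_(x in D) (f x * `|v x|) = 0.
  have E x : f x * `|u x - a| = N * (f x * `|v x|).
    by rewrite /v normrM normfV (gtr0_norm N0); field; exact: lt0r_neq0.
  under eq_Rintegral do rewrite E.
  rewrite RintegralZl// ?v0 ?mulr0//.
  apply: (@integrable_Mbounded _ _ _ 1) => //; first exact: measurableT_comp.
  by move=> x Dx; rewrite normr_id; exact: v1.
have iv : mu.-integrable D (EFin \o (fun x => f x * `|v x|)).
  apply: (@integrable_Mbounded _ _ _ 1) => //; first exact: measurableT_comp.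
  by move=> x Dx; rewrite normr_id; exact: v1.
set I := \int[mu]_(x in D) (f x * `|v x|).
have If : 0 <= \int[mu]_(x in D) `|f x| by exact: Rintegral_ge0.
have bound k : `|I| <= 2 / k.+1%:R * \int[mu]_(x in D) `|f x|.
  have [iq qq0] := q0 (abs_poly R k.+1).
  have -> : I = \int[mu]_(x in D) (f x * `|v x| - f x * (abs_poly R k.+1).[v x]).
    by rewrite RintegralB// qq0 subr0.
  have idq : mu.-integrable D
      (EFin \o (fun x => f x * `|v x| - f x * (abs_poly R k.+1).[v x])).
    exact: integrableB_fun.
  apply: le_trans (le_normr_Rintegral mD idq) _.
  rewrite -RintegralZl//; last exact: integrable_norm.
  apply: le_Rintegral => //.
  - exact: integrable_norm.
  - by apply: integrableZl_fun => //; exact: integrable_norm.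
  move=> x Dx; rewrite -mulrBr normrM mulrC ler_wpM2r//.
  exact: abs_poly_cvg (v1 _ Dx).
apply/eqP; rewrite -normr_eq0 eq_le normr_ge0 andbT.
apply/ler_addgt0Pl => e e0; rewrite addr0.
set J := \int[mu]_(x in D) `|f x| in If bound.
near \oo => k.
apply: le_trans (bound k) _.
have : (2 * J / e) < k%:R by near: k; exact: nbhs_infty_gtr.
rewrite ltr_pdivrMr// => Hk.
rewrite mulrAC ler_pdivrMr//.
apply: le_trans (ltW Hk) _; rewrite mulrC ler_wpM2l ?(ltW e0)//.
by rewrite ler_nat.
Unshelve. all: by end_near. Qed.

Lemma moments_ramp (s t : R) : s < t ->
  \int[mu]_(x in D) (f x * ramp s t (u x)) = 0.
Proof.
move=> st; have iabs a : mu.-integrable D (EFin \o (fun x => f x * `|u x - a|)).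
  apply: (@integrable_Mbounded _ _ _ (M + `|a|)) => //.
    by apply: measurableT_comp => //; exact: measurable_funB.
  move=> x Dx; rewrite normr_id (le_trans (ler_normB _ _))// lerD2r; exact: uM.
have E x : f x * ramp s t (u x) =
   (2 * (t - s))^-1 * ((f x * `|u x - s| - f x * `|u x - t|) + (t - s) * f x).
  by rewrite /ramp; ring.
under eq_Rintegral do rewrite E.
have i1 := integrableB_fun mD (iabs s) (iabs t).
have i2 := integrableZl_fun (t - s) mD fi.
rewrite RintegralZl//; last exact: integrableD_fun.
rewrite RintegralD// RintegralB// !moments_abs subrr add0r RintegralZl//.
have := moment0 0; under eq_Rintegral do rewrite expr0 mulr1.
by move=> ->; rewrite !mulr0.
Qed.

(** The indicator of ]a, +oo[ is the pointwise limit of the ramps from a to a + 1/(k+1). *)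
Lemma moments_ray (a : R) : \int[mu]_(x in D `&` [set x | a < u x]) f x = 0.
Proof.
pose b (k : nat) : R := a + k.+1%:R^-1.
have ab k : a < b k by rewrite ltrDl.
have mA : measurable (D `&` [set x | a < u x]).
  rewrite (_ : _ `&` _ = D `&` u @^-1` `]a, +oo[); first exact: umeas.
  by apply/seteqP; split => x /=; rewrite in_itv/= andbT.
have fm : measurable_fun D f by apply/measurable_EFinP; exact: measurable_int fi.
have DA : D `&` [set x | a < u x] = D `&` (D `&` [set x | a < u x]).
  by rewrite setIA setIid.
rewrite DA; set A := D `&` [set x | a < u x] in mA *.
have mf : measurable_fun D (f \_ A).
  by apply/measurable_restrict => //; apply: measurable_funS fm.
have mr k := measurable_ramp a (b k) umeas.
rewrite Rintegral_mkcondr /Rintegral.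
have [||||| _ _] := @dominated_convergence _ _ _ mu D mD
   (fun k x => (f x * ramp a (b k) (u x))%:E) (EFin \o (f \_ A))
   (EFin \o (Num.norm \o f)).
- by move=> k; apply/measurable_EFinP; exact: measurable_funM.
- exact/measurable_EFinP.
- apply/nearW => x Dx; apply: cvg_near_cst; rewrite /patch /=.
  case: (ltP a (u x)) => ux; last first.
    rewrite memNset//=; last by move=> [_ /=]; rewrite ltNge ux.
    by apply/nearW => k; rewrite ramp_low// mulr0.
  have ux0 : 0 < u x - a by rewrite subr_gt0.
  rewrite mem_set//; near=> k; rewrite ramp_high ?mulr1//.
  by rewrite /b -lerBrDl ltW//; near: k; exact: near_infty_natSinv_lt (PosNum ux0).
- exact: integrable_norm.
- apply/nearW => x k Dx; rewrite /= lee_fin normrM ler_piMr//.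
  by rewrite ger0_norm ?ramp_le1 ?ramp_ge0.
have -> : [sequence (\int[mu]_(x in D) (f x * ramp a (b n) (u x))%:E)%E]_n = cst 0%E.
  apply/funext => k /=; rewrite -[LHS]fineK; last first.
    apply: integrable_fin_num => //; apply: (@integrable_Mbounded _ _ _ 1) => //.
    by move=> x Dx; rewrite ger0_norm ?ramp_le1 ?ramp_ge0.
  by rewrite [fine _]moments_ramp.
by move/cvg_lim => <- //; rewrite lim_cst.
Unshelve. all: by end_near. Qed.

End moments.

(** * Borel and Lebesgue measurability of row vectors *)

Lemma coord_le_norm (R : realType) n (x : 'rV[R]_n) (i : 'I_n) : `|x ord0 i| <= `|x|.
Proof.
rewrite [leRHS]/Num.norm/= mx_normrE.
exact: (le_bigmax 0 (fun ij : 'I_1 * 'I_n => `|x ij.1 ij.2|) (ord0, i)).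
Qed.

Section borel_rV_theory.
Context (R : realType) (n : nat).
Implicit Types (x y : 'rV[R]_n) (i : 'I_n).

Lemma measurable_coord_box (A : 'I_n -> set (measurableTypeR R)) :
  (forall i, measurable (A i)) ->
  measurable ([set x | forall i, A i (coord_rV i x)] : set (borel_rV R n)).
Proof.
move=> mA; rewrite (_ : mkset _ =
    \bigcap_(i in [set: 'I_n]) (@coord_rV R n i @^-1` A i)).
  apply: fin_bigcap_measurable => // i _.
  by rewrite -[X in measurable X]setTI; exact: measurable_coord_rV.
by apply/seteqP; split => [x h i _|x h i]; exact: h.
Qed.

(** Boxes with rational centre and radius 1/(m+1) contained in U cover U, and there are
    countably many of them. Compactness of the pieces also serves to use local
    integrability on U. *)
Lemma open_bigcup_compact_boxes (U : set 'rV[R]_n) : open U ->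
  exists F : (set 'rV[R]_n)^nat, [/\ U = \bigcup_k F k, forall k, compact (F k) &
    forall k, measurable (F k : set (borel_rV R n))].
Proof.
move=> oU.
pose box (qm : 'rV[rat]_n * nat) : set 'rV[R]_n :=
  [set y | forall i, `[(ratr (qm.1 ord0 i) - qm.2.+1%:R^-1 : R),
                       (ratr (qm.1 ord0 i) + qm.2.+1%:R^-1 : R)]%classic (y ord0 i)].
have cbox qm : compact (box qm).
  by apply: (rV_compact (A := fun i => `[(ratr (qm.1 ord0 i) - qm.2.+1%:R^-1 : R),
    (ratr (qm.1 ord0 i) + qm.2.+1%:R^-1 : R)]%classic)) => i; exact: segment_compact.
have mbox qm : measurable (box qm : set (borel_rV R n)).
  apply: (@measurable_coord_box (fun i =>
    `[(ratr (qm.1 ord0 i) - qm.2.+1%:R^-1 : R), (ratr (qm.1 ord0 i) + qm.2.+1%:R^-1 : R)]%classic)).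
  by move=> i; exact: measurable_itv.
pose F k : set 'rV[R]_n := if unpickle k is Some qm then
  (if `[< box qm `<=` U >] then box qm else set0) else set0.
exists F; split; last 2 first.
- move=> k; rewrite /F; case: unpickle => [qm|]; last exact: compact0.
  by case: asboolP => _; [exact: cbox|exact: compact0].
- move=> k; rewrite /F; case: unpickle => [qm|]; last exact: measurable0.
  by case: asboolP => _; [exact: mbox|exact: measurable0].
apply/seteqP; split => [x Ux|x [k _]]; last first.
  by rewrite /F; case: unpickle => // qm; case: asboolP => // h; exact: h.
have /nbhs_ballP[e /= e0 xeU] := open_nbhs_nbhs (conj oU Ux).
have [m _ me] : exists2 m : nat, True & m.+1%:R^-1 < e / 2.
  have e20 : 0 < e / 2 by rewrite divr_gt0.
  have /= := near_infty_natSinv_lt (PosNum e20).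
  by move=> [m _ /(_ m (leqnn _))]; exists m.
have m0 : 0 < m.+1%:R^-1 :> R by [].
have qx i : exists q : rat, `|ratr q - x ord0 i| < m.+1%:R^-1.
  have [q] := @rat_in_itvoo R (x ord0 i - m.+1%:R^-1) (x ord0 i + m.+1%:R^-1) ltac:(by rewrite ltrD2l gtrN).
  by rewrite in_itv/= => /andP[q1 q2]; exists q; rewrite ltr_distl q1 q2.
pose q : 'rV[rat]_n := \row_i projT1 (cid (qx i)).
exists (pickle (q, m)) => //; rewrite /F pickleK.
have xq i : `|ratr (q ord0 i) - x ord0 i| < m.+1%:R^-1.
  by rewrite mxE; case: cid.
have boxE y : box (q, m) y <-> forall i, `|y ord0 i - ratr (q ord0 i)| <= m.+1%:R^-1.
  by split => yq i; have := yq i; rewrite /= in_itv/= ler_distl.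
case: asboolP => [_|[]]; first by apply/boxE => i; rewrite distrC ltW.
move=> y /boxE yq; apply: xeU; split => // i0 i; rewrite ord1.
rewrite /ball/= (le_lt_trans (ler_distD (ratr (q ord0 i)) _ _))// (splitr e).
apply: ltrD; last by rewrite distrC (le_lt_trans (yq i)).
by rewrite distrC (lt_trans (xq i)).
Qed.

Lemma open_measurable_borel_rV (U : set 'rV[R]_n) :
  open U -> measurable (U : set (borel_rV R n)).
Proof.
by move=> /open_bigcup_compact_boxes[F [-> _ mF]]; exact: bigcupT_measurable.
Qed.

Lemma continuous_measurable_borel_rV (f : 'rV[R]_n -> R) :
  continuous f -> measurable_fun setT (f : borel_rV R n -> R).
Proof.
move=> cf; apply: (measurability _ (RGenOInfty.measurableE R)) => //.
move=> _ [_ [a ->] <-]; rewrite setTI.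
apply: open_measurable_borel_rV.
by apply: open_comp => // x _; exact: cf.
Qed.

Lemma borel_measurable_rV (A : set 'rV[R]_n) :
  measurable (A : set (borel_rV R n)) -> measurable A.
Proof. by move=> mA; apply: caratheodory_measurable_mu_ext. Qed.

Lemma borel_measurable_fun_rV d (T : measurableType d) (f : 'rV[R]_n -> T) :
  measurable_fun setT (f : borel_rV R n -> T) -> measurable_fun setT f.
Proof.
move=> mf _ Y mY; apply: borel_measurable_rV; exact: mf.
Qed.

Lemma continuous_measurable_rV (f : 'rV[R]_n -> R) :
  continuous f -> measurable_fun setT f.
Proof. by move=> cf; apply/borel_measurable_fun_rV; exact: continuous_measurable_borel_rV. Qed.

Lemma open_measurable_rV (U : set 'rV[R]_n) : open U -> measurable U.
Proof. by move=> oU; apply: borel_measurable_rV; exact: open_measurable_borel_rV. Qed.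

Lemma closed_measurable_rV (U : set 'rV[R]_n) : closed U -> measurable U.
Proof.
by move=> cU; rewrite -(setCK U); apply/measurableC/open_measurable_rV/closed_openC.
Qed.

Lemma lebesgue_rV_borel (A : set 'rV[R]_n) : measurable (A : set (borel_rV R n)) ->
  lebesgue_rV R n A = borel_lebesgue R n A.
Proof. by move=> mA; exact: measurable_mu_extE. Qed.

(** The identity from the Lebesgue to the Borel sigma-algebra pushes the completed measure
    forward to the original one. *)
Lemma ge0_integral_lebesgue_rV (f : 'rV[R]_n -> \bar R) :
  measurable_fun setT (f : borel_rV R n -> \bar R) ->
  (forall x, 0 <= f x)%E ->
  (\int[lebesgue_rV R n]_x f x = \int[borel_lebesgue R n]_x f x)%E.
Proof.
move=> mf f0.
have mid : measurable_fun setT (id : 'rV[R]_n -> borel_rV R n).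
  by move=> _ Y mY; rewrite setTI; exact: borel_measurable_rV.
have := @ge0_integral_pushforward _ _ 'rV[R]_n (borel_rV R n) R _ mid (lebesgue_rV R n) setT f
  measurableT mf (fun x _ => f0 x).
rewrite preimage_setT => <-.
by apply: eq_measure_integral => A mA _; exact: lebesgue_rV_borel.
Qed.

Lemma bounded_lebesgue_rV_lty (A : set 'rV[R]_n) : bounded_set A ->
  (lebesgue_rV R n A < +oo)%E.
Proof.
move=> [M [_ MA]].
pose N : R := `|M| + 1.
pose B := [set x : borel_rV R n | forall i, `[- N, N]%classic (coord_rV i x)].
have mB : measurable B by apply: (measurable_coord_box (A := fun=> _)) => i.
apply: (@le_lt_trans _ _ (lebesgue_rV R n B)).
  apply: le_outer_measure => x Ax i /=.
  have : `|x : 'rV[R]_n| <= N by apply: MA => //; rewrite /N; have := ler_norm M; lra.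
  by rewrite in_itv/= -ler_norml; apply: le_trans; exact: coord_le_norm.
rewrite lebesgue_rV_borel// (@borel_lebesgue_box R n (fun=> `[- N, N]%classic))//.
rewrite (eq_bigr (fun=> (N *+ 2)%:E)).
  by rewrite -(big_morph EFin (@EFinM R) erefl) ltry.
move=> i _; rewrite lebesgue_measure_itv/= lte_fin.
have N0 : 0 < N by rewrite /N ltr_wpDl.
by rewrite gtrN// -EFinD opprK mulr2n.
Qed.

(** Lebesgue measure is an outer measure computed with countable Borel covers; intersect
    covers that are optimal up to 1/(k+1). *)
Lemma lebesgue_rV_hull (E : set 'rV[R]_n) : (lebesgue_rV R n E < +oo)%E ->
  exists B : set 'rV[R]_n, [/\ measurable (B : set (borel_rV R n)), E `<=` B &
    lebesgue_rV R n B = lebesgue_rV R n E].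
Proof.
move=> Eoo.
have Efin : lebesgue_rV R n E \is a fin_num.
  by rewrite ge0_fin_numE//; exact: outer_measure_ge0.
have H (k : nat) : exists B : set 'rV[R]_n, [/\ measurable (B : set (borel_rV R n)),
    E `<=` B & (lebesgue_rV R n B <= lebesgue_rV R n E + k.+1%:R^-1%:E)%E].
  have k0 : 0 < k.+1%:R^-1 :> R by [].
  have [_ [/= A [mA EA] <-] lt] := lb_ereal_inf_adherent k0 Efin.
  exists (\bigcup_i A i); split => //; first exact: bigcupT_measurable.
  apply: le_trans (ltW lt).
  apply: (le_trans (outer_measure_sigma_subadditive _ A)).
  by apply: lee_nneseries => // i _; rewrite -lebesgue_rV_borel.
pose B k := projT1 (cid (H k)).
have HB k : [/\ measurable (B k : set (borel_rV R n)),
    E `<=` B k & (lebesgue_rV R n (B k) <= lebesgue_rV R n E + k.+1%:R^-1%:E)%E].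
  by rewrite /B; case: cid.
exists (\bigcap_k B k); split.
- by apply: bigcapT_measurable => k; have [] := HB k.
- by move=> x Ex k _; have [_ + _] := HB k; exact.
apply/eqP; rewrite eq_le; apply/andP; split; last first.
  by apply: le_outer_measure => x Ex k _; have [_ + _] := HB k; exact.
apply/lee_addgt0Pr => e e0.
have [k _ /(_ k (leqnn _))/= ke] := near_infty_natSinv_lt (PosNum e0).
have [_ _ Bk] := HB k.
apply: (@le_trans _ _ (lebesgue_rV R n (B k))).
  by apply: le_outer_measure; exact: bigcap_inf.
by apply: le_trans Bk _; rewrite leeD2l// lee_fin ltW.
Qed.

Lemma locally_Lebesgue_integrable_measurable (U : set 'rV[R]_n) (f : 'rV[R]_n -> R) :
  open U -> locally_Lebesgue_integrable U f -> measurable_fun U f.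
Proof.
move=> oU fU; have [F [UF cF mF]] := open_bigcup_compact_boxes oU.
rewrite UF; apply/measurable_fun_bigcup => [k|k]; first exact: borel_measurable_rV.
apply/measurable_EFinP/(measurable_int (lebesgue_rV R n)); apply: fU => //.
by rewrite UF; exact: bigcup_sup.
Qed.

End borel_rV_theory.

(** * Integration along lines and the Loomis-Whitney inequality *)

(** The point with i-th coordinate s and the other coordinates of x: as s varies it runs
    through the line parallel to the i-th axis through x. *)
Definition upd (R : realType) (n : nat) (x : 'rV[R]_n) (i : 'I_n) (s : R) :
  'rV[R]_n := \row_j if j == i then s else x ord0 j.

Section iterated_integrals.
Context (R : realType).
Local Open Scope ereal_scope.

Lemma upd_cons0 n (p : measurableTypeR R * borel_rV R n) (s : R) :
  upd (cons_rV p) ord0 s = cons_rV (s, p.2).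
Proof.
apply/rowP => j; rewrite !mxE; case: unliftP => [k ->|->].
  by rewrite eq_sym (negbTE (neq_lift _ _)).
by rewrite eqxx.
Qed.

Lemma upd_consS n (p : measurableTypeR R * borel_rV R n) (i : 'I_n) (s : R) :
  upd (cons_rV p) (lift ord0 i) s = cons_rV (p.1, upd (p.2 : 'rV[R]_n) i s).
Proof.
apply/rowP => j; rewrite !mxE; case: unliftP => [k ->|->].
  by rewrite (inj_eq lift_inj) !mxE; case: eqP => // _; rewrite liftK.
by rewrite (negbTE (neq_lift _ _)).
Qed.

Section step.
Context n (nu : {sigma_finite_measure set (borel_rV R n) -> \bar R}).
Variable f : borel_rV R n.+1 -> \bar R.
Hypothesis mf : measurable_fun setT f.
Hypothesis f0 : forall x, 0 <= f x.

Let mfc : measurable_fun setT (f \o @cons_rV R n).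
Proof. by apply: measurableT_comp mf _; exact: measurable_cons_rV. Qed.

Let fc0 p : 0 <= (f \o @cons_rV R n) p. Proof. exact: f0. Qed.

Let integral_step : \int[lebesgue_step nu]_x f x =
  \int[(@lebesgue_measure R) \x nu]_p (f \o @cons_rV R n) p.
Proof.
exact: (@ge0_integral_pushforward _ _ _ _ _ _ (@measurable_cons_rV R n)
  ((@lebesgue_measure R) \x nu) _ _ measurableT mf (fun x _ => f0 x)).
Qed.

Lemma integral_lebesgue_step : \int[lebesgue_step nu]_x f x =
  \int[lebesgue_measure]_a \int[nu]_y f (cons_rV (a, y)).
Proof. by rewrite integral_step (fubini_tonelli1 (f \o @cons_rV R n)). Qed.

Lemma integral_lebesgue_step_sym : \int[lebesgue_step nu]_x f x =
  \int[nu]_y \int[lebesgue_measure]_a f (cons_rV (a, y)).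
Proof. by rewrite integral_step (fubini_tonelli2 (f \o @cons_rV R n)). Qed.

Lemma measurable_slice (a : R) :
  measurable_fun setT (fun y : borel_rV R n => f (cons_rV (a, y))).
Proof. exact: (measurableT_comp mfc (measurable_pair1 a)). Qed.

Lemma measurable_slice_integral : measurable_fun setT
  (fun a : measurableTypeR R => \int[nu]_y f (cons_rV (a, y))).
Proof. exact: (measurable_fun_fubini_tonelli_F (f \o @cons_rV R n)). Qed.

Lemma measurable_line_integral : measurable_fun setT
  (fun y : borel_rV R n => \int[lebesgue_measure]_a f (cons_rV (a, y))).
Proof. exact: (measurable_fun_fubini_tonelli_G (f \o @cons_rV R n)). Qed.

End step.

(** Tonelli's theorem, with the integration in the i-th coordinate performed first. Stating
    it as a comparison of two functions avoids any reference to the quotient space of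
    lines. *)
Lemma eq_integral_lines n (i : 'I_n) (f g : borel_rV R n -> \bar R) :
  measurable_fun setT f -> (forall x, 0 <= f x) ->
  measurable_fun setT g -> (forall x, 0 <= g x) ->
  (forall x : 'rV[R]_n, \int[lebesgue_measure]_s f (upd x i s) =
    \int[lebesgue_measure]_s g (upd x i s)) ->
  \int[borel_lebesgue R n]_x f x = \int[borel_lebesgue R n]_x g x.
Proof.
elim: n i f g => [[]//|n IH] i f g mf f0 mg g0 fg.
case: (unliftP ord0 i) fg => [j ->|->] fg.
  rewrite !(integral_lebesgue_step (borel_lebesgue R n))//; apply: eq_integral => a _.
  apply: (IH j); [exact: measurable_slice|by []|exact: measurable_slice|by []|].
  move=> y; have := fg (cons_rV (a, y)).
  by under eq_integral do rewrite upd_consS; under [in RHS]eq_integral do rewrite upd_consS.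
rewrite !(integral_lebesgue_step_sym (borel_lebesgue R n))//; apply: eq_integral => y _.
have := fg (cons_rV (0%R, y)).
by under eq_integral do rewrite upd_cons0; under [in RHS]eq_integral do rewrite upd_cons0.
Qed.

Lemma lee_expe (x y : \bar R) k : 0 <= x -> x <= y -> x ^+ k <= y ^+ k.
Proof.
move=> x0 xy; elim: k => // k IH.
by rewrite !expeS lee_pmul// expe_ge0.
Qed.

Lemma expeMl (x y : \bar R) k : (x * y) ^+ k = x ^+ k * y ^+ k.
Proof. by elim: k => [|k IH]; rewrite ?expe0 ?mul1e// !expeS IH muleACA. Qed.

Let lines_ge1 n (E : set (borel_rV R n)) (h : borel_rV R n -> \bar R) :=
  forall x i, E x -> 1 <= \int[lebesgue_measure]_s h (upd (x : 'rV[R]_n) i s).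

(** Let H be the integral of h, and slice E and h at first coordinate a into E_a and h_a.
    Integrating the bound 1 <= int h over the lines in the first direction gives
    |E_a| <= H, and induction gives |E_a|^m <= (int h_a)^(m+1). Multiplying,
    |E_a|^(m+1) <= H (int h_a)^(m+1), that is |E_a| <= H^(1/(m+1)) int h_a, which is
    integrated over a. *)
Lemma loomis_whitney_step n (nu : {sigma_finite_measure set (borel_rV R n) -> \bar R}) m
    (E : set (borel_rV R n.+1)) (h : borel_rV R n.+1 -> \bar R) :
  (forall (E' : set (borel_rV R n)) (h' : borel_rV R n -> \bar R),
    measurable E' -> E' !=set0 -> measurable_fun setT h' -> (forall x, 0 <= h' x) ->
    lines_ge1 E' h' -> nu E' ^+ m <= (\int[nu]_x h' x) ^+ m.+1) ->
  measurable E -> measurable_fun setT h -> (forall x, 0 <= h x) ->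
  lines_ge1 E h ->
  lebesgue_step nu E ^+ m.+1 <= (\int[lebesgue_step nu]_x h x) ^+ m.+2.
Proof.
move=> IH mE mh h0 Eh.
set H := \int[lebesgue_step nu]_x h x.
have H0 : 0 <= H by exact: integral_ge0.
have [->|Hoo] := eqVneq H +oo; first by rewrite [leRHS]expeS gt0_mulye ?leey// expe_gt0.
have Hfin : H \is a fin_num by rewrite ge0_fin_numE// ltey.
pose Es (a : R) : set (borel_rV R n) := [set y | E (cons_rV (a, y))].
have m1E : measurable_fun setT (fun x => (\1_E x)%:E : \bar R).
  by apply/measurable_EFinP; exact: measurable_indic.
have p1E x : 0 <= (\1_E x)%:E :> \bar R by rewrite lee_fin.
have E1 a y : \1_E (cons_rV (a, y)) = \1_(Es a) y :> R.
  by rewrite !indicE; congr (_%:R); congr nat_of_bool; apply/idP/idP; rewrite !inE.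
have mEs a : measurable (Es a).
  have := measurable_slice m1E a.
  move=> /measurable_EFinP; under eq_fun do rewrite E1.
  by move/measurable_indicP.
have muE : lebesgue_step nu E = \int[lebesgue_measure]_a nu (Es a).
  rewrite -[X in lebesgue_step _ X = _](setIT E) -integral_indic// integral_lebesgue_step//.
  apply: eq_integral => a _; under eq_integral do rewrite E1.
  by rewrite integral_indic// setIT.
have mmuE : measurable_fun setT (fun a : measurableTypeR R => nu (Es a)).
  have := measurable_slice_integral nu m1E p1E.
  under eq_fun => a.
    under eq_integral do rewrite E1.
    rewrite integral_indic// setIT; over.
  by [].
pose Hs (a : R) := \int[nu]_y h (cons_rV (a, y)).
have Hs0 a : 0 <= Hs a by exact: integral_ge0.
have mHs : measurable_fun setT (Hs : measurableTypeR R -> _) by exact: measurable_slice_integral.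
have EsH a : nu (Es a) <= H.
  rewrite -(setIT (Es a)) -integral_indic// /H integral_lebesgue_step_sym//.
  apply: ge0_le_integral => //.
  - by apply/measurable_EFinP; exact: measurable_indic.
  - exact: measurable_line_integral.
  move=> y _; rewrite indicE; case: (boolP (y \in Es a)) => [|_]; last exact: integral_ge0.
  rewrite inE => Ey; have := Eh _ ord0 Ey.
  by under eq_integral do rewrite upd_cons0.
have EsHs a : Es a !=set0 -> nu (Es a) ^+ m <= Hs a ^+ m.+1.
  move=> Es0; apply: IH => //; first exact: measurable_slice.
  by move=> y i Ey; have := Eh _ (lift ord0 i) Ey; under eq_integral do rewrite upd_consS.
(* The root H^(1/(m+1)) of the total integral. *)
have [r r0 rH] : exists2 r : R, (0 <= r)%R & (r ^+ m.+1)%:E = H.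
  exists ((fine H) `^ (m.+1%:R^-1))%R; first exact: powR_ge0.
  by rewrite -powR_mulrn ?powR_ge0// -powRrM mulVf ?pnatr_eq0// powRr1 ?fineK// fine_ge0.
have key a : nu (Es a) <= r%:E * Hs a.
  have [->|/set0P Es0] := eqVneq (Es a) set0.
    by rewrite measure0 mule_ge0.
  have [r00|r00] := eqVneq r 0%R.
    rewrite r00 mul0e; move: (EsH a).
    by rewrite -rH r00 expr0n.
  have [->|Hsoo] := eqVneq (Hs a) +oo.
    by rewrite gt0_muley ?leey// lte_fin lt_neqAle eq_sym r00.
  have Hsfin : Hs a \is a fin_num by rewrite ge0_fin_numE// ltey.
  have mufin : nu (Es a) \is a fin_num.
    by rewrite ge0_fin_numE// (le_lt_trans (EsH a))// -rH ltry.
  have : nu (Es a) ^+ m.+1 <= (r%:E * Hs a) ^+ m.+1.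
    rewrite expeS expeMl -EFin_expe rH; apply: lee_pmul => //; last exact: EsHs.
    exact: expe_ge0.
  rewrite -(fineK Hsfin) -(fineK mufin) -EFinM -!EFin_expe !lee_fin.
  by rewrite ler_pXn2r// nnegrE ?mulr_ge0// fine_ge0.
have le : lebesgue_step nu E <= r%:E * H.
  have mrHs : measurable_fun setT (fun a : measurableTypeR R => r%:E * Hs a).
    exact: emeasurable_funM.
  have -> : r%:E * H = \int[lebesgue_measure]_a (r%:E * Hs a).
    by rewrite ge0_integralZl_EFin// /H integral_lebesgue_step.
  by rewrite muE; apply: ge0_le_integral => // a _; rewrite ?mule_ge0.
apply: (@le_trans _ _ ((r%:E * H) ^+ m.+1)); first exact: lee_expe.
by rewrite expeMl -EFin_expe rH -expeS.
Qed.

(** This replaces the usual product of n functions by a single h dominating all of them,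
    which is all that a Sobolev inequality up to a constant requires. *)
Lemma loomis_whitney n (E : set (borel_rV R n)) (h : borel_rV R n -> \bar R) :
  (0 < n)%N -> measurable E -> E !=set0 -> measurable_fun setT h -> (forall x, 0 <= h x) ->
  lines_ge1 E h ->
  borel_lebesgue R n E ^+ n.-1 <= (\int[borel_lebesgue R n]_x h x) ^+ n.
Proof.
case: n E h => // m E h _.
elim: m E h => [|m IH] E h mE [x0 Ex0] mh h0 Eh; last exact: loomis_whitney_step.
rewrite expe0 (_ : forall x : \bar R, x ^+ 1 = x)//.
rewrite (integral_lebesgue_step_sym (borel_lebesgue R 0))// [borel_lebesgue R 0]/=.
rewrite integral_dirac//; last exact: measurable_line_integral.
rewrite diracT mul1e.
have := Eh x0 ord0 Ex0; rewrite -[x0]uncons_rVK.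
under eq_integral do rewrite upd_cons0.
by rewrite (_ : (uncons_rV x0).2 = (0%R : 'rV[R]_0))//; apply/rowP => -[].
Qed.

End iterated_integrals.

(** * Calculus of smooth functions and test functions *)

Section smooth_calculus.
Context (R : realType) (n : nat).
Implicit Types (f g : 'rV[R]_n -> R) (i j : 'I_n).

Local Notation e_ i := (delta_mx ord0 i : 'rV[R]_n).

Lemma partialD f g i : (forall x, derivable f x (e_ i)) -> (forall x, derivable g x (e_ i)) ->
  partial i (fun x => f x + g x) = (fun x => partial i f x + partial i g x).
Proof. by move=> df dg; apply/funext => x; exact: deriveD. Qed.

Lemma partialM f g i : (forall x, derivable f x (e_ i)) -> (forall x, derivable g x (e_ i)) ->
  partial i (fun x => f x * g x) = (fun x => f x * partial i g x + g x * partial i f x).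
Proof. by move=> df dg; apply/funext => x; exact: deriveM. Qed.

Lemma partial_cst i (c : R) : partial i (fun=> c) = fun=> 0.
Proof. by apply/funext => x; exact: derive_cst. Qed.

Lemma is_derive_coord (x : 'rV[R]_n) i j :
  is_derive x (e_ i) (fun y : 'rV[R]_n => y ord0 j) (j == i)%:R.
Proof.
have H : ((fun h => h^-1 *: (((fun y : 'rV[R]_n => y ord0 j) \o shift x) (h *: e_ i)
    - x ord0 j)) @ 0^' --> ((j == i)%:R : R)).
  apply: cvg_near_cst; near=> h.
  rewrite /= !mxE eqxx /= addrK /GRing.scale/= mulKf//.
  by near: h; exact: nbhs_dnbhs_neq.
by split; [apply/cvg_ex; exists (j == i)%:R|exact/cvg_lim].
Unshelve. all: by end_near. Qed.

Lemma partial_coord i j : partial i (fun y : 'rV[R]_n => y ord0 j) = fun=> (j == i)%:R.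
Proof. by apply/funext => x; have [] := is_derive_coord x i j. Qed.

(** Smoothness quantifies over all iterated partial derivatives, for which a product has no
    simple formula. This class is closed under partial derivatives by construction, and
    each of its members is continuous and derivable, so all its members are smooth. *)
Inductive smooth_expr : ('rV[R]_n -> R) -> Prop :=
| smooth_base f : smooth f -> smooth_expr f
| smooth_const c : smooth_expr (fun=> c)
| smooth_var j : smooth_expr (fun x => x ord0 j)
| smooth_add f g : smooth_expr f -> smooth_expr g -> smooth_expr (fun x => f x + g x)
| smooth_mul f g : smooth_expr f -> smooth_expr g -> smooth_expr (fun x => f x * g x).

Lemma smooth_partial f i : smooth f -> smooth (partial i f).
Proof. by move=> sf s; have := sf (rcons s i); rewrite foldr_rcons. Qed.

Lemma smooth_continuous f : smooth f -> continuous f.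
Proof. by move=> /(_ [::])[]. Qed.

Lemma smooth_derivable f i x : smooth f -> derivable f x (e_ i).
Proof. by move=> /(_ [::])[_]; exact. Qed.

Lemma smooth_expr_derivable f : smooth_expr f ->
  continuous f /\ forall i x, derivable f x (e_ i).
Proof.
elim=> {f} [f sf|c|j|f g _ [cf df] _ [cg dg]|f g _ [cf df] _ [cg dg]]; split.
- exact: smooth_continuous.
- by move=> i x; exact: smooth_derivable.
- exact: cst_continuous.
- by move=> i x; exact: derivable_cst.
- exact: coord_continuous.
- by move=> i x; have [] := is_derive_coord x i j.
- by move=> x; apply: continuousD; [exact: cf|exact: cg].
- by move=> i x; apply: derivableD.
- by move=> x; apply: continuousM; [exact: cf|exact: cg].
- by move=> i x; apply: derivableM.
Qed.

Lemma smooth_expr_partial f i : smooth_expr f -> smooth_expr (partial i f).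
Proof.
elim=> {f} [f sf|c|j|f g sf IHf sg IHg|f g sf IHf sg IHg].
- exact/smooth_base/smooth_partial.
- by rewrite partial_cst; exact: smooth_const.
- by rewrite partial_coord; exact: smooth_const.
- have [_ df] := smooth_expr_derivable sf; have [_ dg] := smooth_expr_derivable sg.
  by rewrite partialD//; exact: smooth_add.
- have [_ df] := smooth_expr_derivable sf; have [_ dg] := smooth_expr_derivable sg.
  by rewrite partialM//; apply: smooth_add; exact: smooth_mul.
Qed.

Lemma smooth_exprP f : smooth_expr f -> smooth f.
Proof.
move=> sf s; apply: smooth_expr_derivable.
by elim: s => //= i s IH; exact: smooth_expr_partial.
Qed.

Lemma smoothM f g : smooth f -> smooth g -> smooth (fun x => f x * g x).
Proof. by move=> sf sg; apply/smooth_exprP/smooth_mul; exact: smooth_base. Qed.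

Lemma smoothX f k : smooth f -> smooth (fun x => f x ^+ k).
Proof.
move=> sf; elim: k => [|k IH].
  by under eq_fun do rewrite expr0; exact/smooth_exprP/smooth_const.
by under eq_fun do rewrite exprS; exact: smoothM.
Qed.

Lemma partialX f k i : smooth f ->
  partial i (fun x => f x ^+ k.+1) = fun x => k.+1%:R * f x ^+ k * partial i f x.
Proof.
move=> sf; elim: k => [|k IH].
  by under eq_fun do rewrite expr1; apply/funext => x; rewrite expr0 !mul1r.
under eq_fun do rewrite exprS.
rewrite partialM; first last.
- by move=> x; apply: smooth_derivable; exact: smoothX.
- by move=> x; exact: smooth_derivable.
by rewrite IH; apply/funext => x; rewrite [k.+2%:R]mulrS exprS; ring.
Qed.

Lemma partial_notin_support f i x : ~ closure [set y | f y != 0] x -> partial i f x = 0.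
Proof.
move=> fx; have ox : open (~` closure [set y | f y != 0]) by exact/closed_openC/closed_closure.
have nx : \forall y \near x, f y = 0.
  have := open_nbhs_nbhs (conj ox fx); apply: filterS => y yf.
  by apply/eqP/negP => /negP fy; apply: yf; exact: subset_closure.
transitivity ('D_(e_ i) (fun=> 0 : R) x); last exact: derive_cst.
exact: (near_eq_derive _ nx).
Qed.

Section test_functions.
Variables (Omega : set 'rV[R]_n).
Implicit Types eta : 'rV[R]_n -> R.

Lemma test_functionM eta p : test_function Omega eta -> smooth p ->
  test_function Omega (fun x => eta x * p x).
Proof.
move=> [se ce eO] sp.
have sub : closure [set x | eta x * p x != 0] `<=` closure [set x | eta x != 0].
  by apply: closure_subset => x /=; apply: contra => /eqP ->; rewrite mul0r.
split; first exact: smoothM.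
  by apply: subclosed_compact ce sub; exact: closed_closure.
exact: subset_trans sub eO.
Qed.

Lemma test_functionX eta k : test_function Omega eta ->
  test_function Omega (fun x => eta x ^+ k.+1).
Proof.
move=> te; under eq_fun do rewrite exprS; apply: test_functionM => //.
by apply: smoothX; case: te.
Qed.

Lemma test_function_partial eta i : test_function Omega eta ->
  test_function Omega (partial i eta).
Proof.
move=> [se ce eO].
have sub : closure [set x | partial i eta x != 0] `<=` closure [set x | eta x != 0].
  rewrite [X in _ `<=` X](iffLR (closure_id _) (@closed_closure _ _)).
  apply: closure_subset => x /= pe; apply: contrapT => /partial_notin_support pe0.
  by rewrite pe0 eqxx in pe.
split; first exact: smooth_partial.
  by apply: subclosed_compact ce sub; exact: closed_closure.
exact: subset_trans sub eO.
Qed.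

Lemma test_function_bounded eta : test_function Omega eta ->
  exists2 M, 0 <= M & forall x, `|eta x| <= M.
Proof.
move=> [/smooth_continuous ce cpt _].
have /compact_bounded[M [_ MA]] : compact [set eta x | x in closure [set x | eta x != 0]].
  by apply: continuous_compact => //; exact: continuous_subspaceT.
exists (`|M| + 1); first by rewrite addr_ge0.
move=> x; have [->|ex] := eqVneq (eta x) 0; first by rewrite normr0 addr_ge0.
apply: (MA (`|M| + 1)); first by rewrite ltr_pwDr// ler_norm.
by exists x => //; exact: subset_closure.
Qed.

Lemma test_function_support_bounded eta : test_function Omega eta ->
  exists2 N : R, 0 < N & forall (x : 'rV[R]_n) i, N <= `|x ord0 i| -> ~ closure [set x | eta x != 0] x.
Proof.
move=> [_ /compact_bounded[M [_ MA]] _]; exists (`|M| + 2); first by rewrite ltr_wpDl.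
move=> x i Nx cx; have xM : `|x| <= `|M| + 1.
  by apply: MA cx; rewrite ltr_pwDr// ler_norm.
have := le_trans Nx (le_trans (coord_le_norm x i) xM).
by rewrite lerD2l; lra.
Qed.

End test_functions.
End smooth_calculus.

(** * The fundamental theorem of calculus on a line *)

Section one_variable.
Context (R : realType).
Implicit Types (F f : R -> R).

Lemma integral_derive_C1 F f (a b : R) : a < b ->
  (forall s : R, is_derive s 1 F (f s)) -> continuous f ->
  (\int[lebesgue_measure]_(s in `[a, b]) (f s)%:E = (F b)%:E - (F a)%:E)%E.
Proof.
move=> ab dF cf.
have dF' s : derivable F s 1 by [].
have cF : continuous F.
  by move=> s; apply: differentiable_continuous; exact/derivable1_diffP.
apply: continuous_FTC2 => //.
- exact: continuous_subspaceT.
- split => //.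
  + exact/cvg_at_right_filter/cF.
  + exact/cvg_at_left_filter/cF.
- by move=> s _; rewrite derive1E; exact: derive_val.
Qed.

Lemma integral_itv_supp (f : R -> \bar R) (N : R) :
  (forall s, N < `|s| -> f s = 0%E) ->
  (\int[lebesgue_measure]_s f s = \int[lebesgue_measure]_(s in `[(- N)%R, N]) f s)%E.
Proof.
move=> fN; rewrite [RHS]integral_mkcond; apply: eq_integral => s _.
rewrite /patch; case: ifPn => // sN; apply: fN.
move: sN; apply: contraNlt; rewrite ler_norml => sN.
by rewrite inE/= in_itv.
Qed.

(** [eq_integral_lines] compares nonnegative functions only, so the vanishing of the integral
    of F' for a compactly supported F is expressed by comparing |F'| + F' with |F'|. *)
Lemma integral_norm_add_derive F f (N : R) : 0 < N ->
  (forall s : R, is_derive s 1 F (f s)) -> continuous f ->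
  F (- N) = F N -> (forall s, N < `|s| -> f s = 0) ->
  (\int[lebesgue_measure]_s (`|f s| + f s)%:E =
   \int[lebesgue_measure]_s (`|f s|)%:E)%E.
Proof.
move=> N0 dF cf FN fN.
have NN : - N < N by rewrite gtrN.
rewrite !(@integral_itv_supp _ N); [|by move=> s /fN->; rewrite normr0 ?addr0..].
have cpt : compact `[- N, N]%classic by exact: segment_compact.
have fi : lebesgue_measure.-integrable `[- N, N] (EFin \o f).
  by apply: continuous_compact_integrable => //; exact: continuous_subspaceT.
have fi' : lebesgue_measure.-integrable `[- N, N] (EFin \o (Num.norm \o f)).
  exact: integrable_norm.
under eq_integral do rewrite EFinD.
have := integral_derive_C1 NN dF cf; rewrite FN subee// => f0.
by rewrite integralD_EFin// f0 adde0.
Qed.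

(** The Caratheodory slope works because x |x| - y |y| differs from 2 |y| (x - y) by at most
    (x - y)^2. *)
Lemma is_derive_mulr_norm (y : R) : is_derive y 1 (fun x : R => x * `|x|) (2 * `|y|).
Proof.
apply/is_derive1_caratheodory.
pose g z := if z == y then 2 * `|y| else (z * `|z| - y * `|y|) / (z - y).
have quad z : `|z * `|z| - y * `|y| - 2 * `|y| * (z - y)| <= (z - y) ^+ 2.
  have zy2 := sqr_ge0 (z - y); have z2 := sqr_ge0 z; have y2 := sqr_ge0 y.
  have [z0|z0] := leP 0 z; have [y0|y0] := leP 0 y.
  - rewrite (ger0_norm z0) (ger0_norm y0) ler_norml; apply/andP; split; nra.
  - rewrite (ger0_norm z0) (ltr0_norm y0) ler_norml.
    have zy0 : z * y <= 0 by rewrite mulr_ge0_le0// ltW.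
    apply/andP; split; nra.
  - rewrite (ltr0_norm z0) (ger0_norm y0) ler_norml.
    have zy0 : z * y <= 0 by rewrite mulr_le0_ge0// ltW.
    apply/andP; split; nra.
  - rewrite (ltr0_norm z0) (ltr0_norm y0) ler_norml; apply/andP; split; nra.
exists g; split; last by rewrite /g eqxx.
  move=> z; rewrite /g; have [->|zy] := eqVneq z y; first by rewrite !subrr mulr0.
  by rewrite divfK// subr_eq0.
apply/cvgrPdist_le => e e0.
have gy z : `|g y - g z| <= `|y - z|.
  rewrite {1}/g eqxx /g; have [->|zy] := eqVneq z y; first by rewrite subrr normr0.
  have zy0 : 0 < `|z - y| by rewrite normr_gt0 subr_eq0.
  rewrite -(ler_pM2r zy0) [`|y - z|]distrC -expr2 real_normK ?num_real//.
  rewrite distrC -normrM mulrBl divfK ?subr_eq0//; exact: quad.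
near=> z; apply: le_trans (gy z) _.
by near: z; apply: (iffLR (@cvgrPdist_le _ _ _ _ _ (id : R -> R) y)) => //; exact: cvg_id.
Unshelve. all: by end_near. Qed.

(** A primitive of the ramp, x |x| / 2 being a primitive of |x|. *)
Definition ramp_primitive (s t y : R) : R :=
  ((y - s) * `|y - s| - (y - t) * `|y - t| + 2 * (t - s) * y) / (4 * (t - s)).

Lemma is_derive_ramp_primitive (s t y : R) : s < t ->
  is_derive y 1 (ramp_primitive s t) (ramp s t y).
Proof.
move=> st.
have H a : is_derive y 1 (fun y : R => (y - a) * `|y - a|) (2 * `|y - a|).
  have d1 : is_derive y 1 (fun y : R => y - a) 1.
    by rewrite -[X in is_derive _ _ _ X]subr0; exact: is_deriveB.
  have := @is_derive1_comp R (fun x => x * `|x|) (fun y => y - a) y _ _ (is_derive_mulr_norm (y - a)) d1.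
  by rewrite mulr1.
have H2 : is_derive y 1 (fun y : R => 2 * (t - s) * y) (2 * (t - s)).
  rewrite -[X in is_derive _ _ _ X]mulr1; exact: is_deriveZ.
have H3 := is_deriveD (is_deriveB (H s) (H t)) H2.
rewrite (_ : ramp s t y =
    (4 * (t - s))^-1 *: (2 * `|y - s| - 2 * `|y - t| + 2 * (t - s))); last first.
  rewrite /ramp /GRing.scale/=; field; rewrite gt_eqF// subr_gt0//.
rewrite (_ : ramp_primitive s t = (4 * (t - s))^-1 \*:
    (((fun y => (y - s) * `|y - s|) - (fun y => (y - t) * `|y - t|)) + *%R (2 * (t - s)))).
  exact: is_deriveZ.
by apply/funext => z; rewrite /ramp_primitive mulrC.
Qed.

Lemma continuous_ramp (s t : R) : continuous (ramp s t).
Proof.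
move=> y; apply: cvgMl; apply: cvgD; last exact: cvg_cst.
by apply: cvgB; apply: cvg_norm; apply: cvgB; [exact: cvg_id|exact: cvg_cst|exact: cvg_id|exact: cvg_cst].
Qed.

Lemma ramp_primitive_growth (s t y : R) : 0 <= s -> s < t -> t <= y ->
  (t - s) / 2 <= ramp_primitive s t y - ramp_primitive s t 0.
Proof.
move=> s0 st ty; have ts : t - s != 0 by rewrite gt_eqF// subr_gt0.
rewrite /ramp_primitive.
have -> : `|y - s| = y - s by rewrite ger0_norm//; lra.
have -> : `|y - t| = y - t by rewrite ger0_norm//; lra.
have -> : `|0 - s| = s by rewrite sub0r normrN ger0_norm.
have -> : `|0 - t| = t by rewrite sub0r normrN ger0_norm//; lra.
have -> : ((y - s) * (y - s) - (y - t) * (y - t) + 2 * (t - s) * y) / (4 * (t - s)) -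
   ((0 - s) * s - (0 - t) * t + 2 * (t - s) * 0) / (4 * (t - s)) = y - (s + t) / 2.
  by field.
by lra.
Qed.

(** Along the line F climbs from 0 to at least t, so the composition of F with the primitive
    of the ramp grows by at least (t - s) / 2. *)
Lemma line_growth (s t : R) (F f : R -> R) (N a : R) :
  0 <= s -> s < t -> (forall x : R, is_derive x 1 F (f x)) -> continuous f ->
  F (- N) = 0 -> - N < a -> t <= F a ->
  (((t - s) / 2)%:E <= \int[lebesgue_measure]_x (ramp s t (F x) * `|f x|)%:E)%E.
Proof.
move=> s0 st dF cf FN Na tF.
have cF : continuous F.
  by move=> x; apply: differentiable_continuous; apply/derivable1_diffP.
have dG (x : R) : is_derive x 1 (ramp_primitive s t \o F) (ramp s t (F x) * f x).
  exact: is_derive1_comp (is_derive_ramp_primitive (F x) st) (dF x).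
have cr : continuous (fun x => ramp s t (F x)).
  by move=> x; apply: continuous_comp; [exact: cF|exact: continuous_ramp].
have cg : continuous (fun x => ramp s t (F x) * f x).
  by move=> x; apply: cvgM; [exact: cr|exact: cf].
have cg' : continuous (fun x => ramp s t (F x) * `|f x|).
  by move=> x; apply: cvgM; [exact: cr|apply: cvg_norm; exact: cf].
have := integral_derive_C1 Na dG cg; rewrite /= FN => E.
have cint g : continuous g -> lebesgue_measure.-integrable `[- N, a] (EFin \o g).
  move=> ?; apply: continuous_compact_integrable; first exact: segment_compact.
  exact: continuous_subspaceT.
apply: (@le_trans _ _ (\int[lebesgue_measure]_(x in `[(- N)%R, a]) (ramp s t (F x) * f x)%:E)%E).
  by rewrite E -EFinB lee_fin ramp_primitive_growth.
apply: (@le_trans _ _ (\int[lebesgue_measure]_(x in `[(- N)%R, a]) (ramp s t (F x) * `|f x|)%:E)%E).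
  apply: le_integral => //; [exact: cint|exact: cint|].
  by move=> x _; rewrite lee_fin ler_wpM2l ?ramp_ge0// ler_norm.
apply: ge0_subset_integral => //.
  by apply/measurable_EFinP; exact: continuous_measurable_fun.
by move=> x _; rewrite lee_fin mulr_ge0 ?ramp_ge0.
Qed.

End one_variable.

(** * A Sobolev inequality for the level sets of a test function *)

Section continuity.
Context (R : realType) (T : topologicalType).
Implicit Types f g : T -> R.

Lemma continuous_addR f g : continuous f -> continuous g ->
  continuous (fun x => f x + g x).
Proof. by move=> cf cg x; exact: (cvgD (cf x) (cg x)). Qed.

Lemma continuous_mulR f g : continuous f -> continuous g ->
  continuous (fun x => f x * g x).
Proof. by move=> cf cg x; exact: (cvgM (cf x) (cg x)). Qed.

Lemma continuous_normR f : continuous f -> continuous (fun x => `|f x|).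
Proof. by move=> cf x; exact: (cvg_norm (cf x)). Qed.

Lemma continuous_sumR (I : finType) (f : I -> T -> R) :
  (forall i, continuous (f i)) -> continuous (fun x => \sum_i f i x).
Proof.
move=> cf; elim: (index_enum I) => [|i r IH].
  by under eq_fun do rewrite big_nil; exact: cst_continuous.
under eq_fun do rewrite big_cons; exact: continuous_addR.
Qed.

Lemma continuous_compR (U : topologicalType) (g : U -> T) f :
  continuous f -> continuous g -> continuous (fun x => f (g x)).
Proof. by move=> cf cg x; apply: continuous_comp; [exact: cg|exact: cf]. Qed.

End continuity.

Section lines.
Context (R : realType) (n : nat).
Implicit Types (f : 'rV[R]_n -> R) (x : 'rV[R]_n) (i : 'I_n).

Lemma updE x i (s : R) : upd x i s = s *: delta_mx ord0 i + upd x i 0.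
Proof.
apply/rowP => j; rewrite !mxE eqxx/=.
by case: eqP => _; rewrite ?mulr1 ?mulr0 ?addr0 ?add0r.
Qed.

Lemma upd_self x i : upd x i (x ord0 i) = x.
Proof. by apply/rowP => j; rewrite mxE; case: eqP => // ->. Qed.

Lemma continuous_upd x i : continuous (upd x i).
Proof.
rewrite (_ : upd x i = fun s => s *: delta_mx ord0 i + upd x i 0).
  by move=> s; apply: cvgD; [apply: cvgZr_tmp; exact: cvg_id|exact: cvg_cst].
by apply/funext => s; exact: updE.
Qed.

Lemma is_derive_line f x i (s : R) : derivable f (upd x i s) (delta_mx ord0 i) ->
  is_derive s 1 (fun t => f (upd x i t)) (partial i f (upd x i s)).
Proof.
have E : (fun h : R => h^-1 *: (((fun t => f (upd x i t)) \o shift s) (h *: 1) - f (upd x i s)))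
  = (fun h : R => h^-1 *: ((f \o shift (upd x i s)) (h *: delta_mx ord0 i) - f (upd x i s))).
  apply/funext => h /=; congr (_ *: (f _ - _)).
  by rewrite updE [upd x i s]updE scalerDl /GRing.scale/= mulr1 addrA.
move=> df; split; first by rewrite /derivable E.
by rewrite /derive E.
Qed.

Lemma eq_Rintegral_lines i f : continuous f ->
  (lebesgue_rV R n).-integrable setT (EFin \o f) ->
  (forall x, (\int[lebesgue_measure]_s (`|f (upd x i s)| + f (upd x i s))%:E =
     \int[lebesgue_measure]_s (`|f (upd x i s)|)%:E)%E) ->
  \int[lebesgue_rV R n]_x f x = 0.
Proof.
move=> cf fi lf.
have cn : continuous (fun x : 'rV[R]_n => `|f x|) by exact: continuous_normR.
have cs : continuous (fun x : 'rV[R]_n => `|f x| + f x).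
  exact: continuous_addR.
have s0 x : 0 <= `|f x| + f x by have := ler_norm (- f x); rewrite normrN; lra.
have mcont (g : 'rV[R]_n -> R) : continuous g -> measurable_fun setT (fun x : borel_rV R n => (g x)%:E).
  by move=> cg; apply/measurable_EFinP; exact: continuous_measurable_borel_rV.
have := @eq_integral_lines R n i (fun x => (`|f x| + f x)%:E) (fun x => (`|f x|)%:E)
  (mcont _ cs) s0 (mcont _ cn) (fun x => normr_ge0 _) lf.
rewrite -!ge0_integral_lebesgue_rV//; [|exact: mcont..] => E.
have fi' := integrable_norm fi.
have : \int[lebesgue_rV R n]_x (`|f x| + f x) = \int[lebesgue_rV R n]_x `|f x|.
  by rewrite /Rintegral E.
by rewrite RintegralD// => /eqP; rewrite -subr_eq0 addrC addKr => /eqP.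
Qed.

Section test_functions.
Variables (Omega : set 'rV[R]_n).
Implicit Types eta : 'rV[R]_n -> R.

Lemma test_function_integrable eta : test_function Omega eta ->
  (lebesgue_rV R n).-integrable setT (EFin \o eta).
Proof.
move=> te; have [M M0 etaM] := test_function_bounded te.
have [se ce eO] := te.
set D := closure [set x | eta x != 0] in ce.
have mD : measurable D by apply: closed_measurable_rV; exact: closed_closure.
have me : measurable_fun setT eta by exact/continuous_measurable_rV/smooth_continuous.
have : (lebesgue_rV R n).-integrable D (EFin \o eta).
  apply: measurable_bounded_integrable => //.
  - exact/bounded_lebesgue_rV_lty/compact_bounded.
  - exact: measurable_funTS.
  - by exists M; split; [exact: num_real|move=> y My x _; exact: le_trans (etaM x) (ltW My)].
move=> /(integrable_mkcond _ mD); apply: eq_integrable => // x _.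
rewrite /patch; case: ifPn => //= xD; congr EFin; apply/esym/eqP.
apply: contraNT xD => ex; rewrite inE; exact: subset_closure.
Qed.

Lemma integral_partial0 eta i : test_function Omega eta ->
  \int[lebesgue_rV R n]_x partial i eta x = 0.
Proof.
move=> te; have [se ce eO] := te.
have [N N0 eN] := test_function_support_bounded te.
have tp := test_function_partial i te.
apply: (eq_Rintegral_lines (i := i)).
- by apply: smooth_continuous; case: tp.
- exact: test_function_integrable.
have out x s : N <= `|s| -> ~ closure [set x | eta x != 0] (upd x i s).
  by move=> Ns; apply: (eN _ i); rewrite mxE eqxx.
have e0 x s : N <= `|s| -> eta (upd x i s) = 0.
  move=> /out h; apply/eqP/negP => /negP ex; apply: (h x); exact: subset_closure.
move=> x; apply: (@integral_norm_add_derive R (fun s => eta (upd x i s)) _ N) => //.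
- by move=> s; apply: is_derive_line; exact: smooth_derivable.
- move=> s; apply: continuous_comp; first exact: continuous_upd.
  by apply: smooth_continuous; case: tp.
- by rewrite !e0// ?normrN ger0_norm// ltW.
- by move=> s Ns; apply: partial_notin_support; apply: out; exact: ltW.
Qed.

End test_functions.
End lines.

Section sobolev_level.
Context (R : realType) (n : nat) (n1 : (1 < n)%N).
Variables (Omega : set 'rV[R]_n) (eta : 'rV[R]_n -> R).
Hypothesis te : test_function Omega eta.
Variables (s t : R).
Hypotheses (s0 : 0 <= s) (st : s < t).

Let h x := ramp s t (eta x) * \sum_i `|partial i eta x|.

Lemma continuous_ramp_gradient : continuous h.
Proof.
have [se _ _] := te.
apply: continuous_mulR.
  by apply: continuous_compR; [exact: continuous_ramp|exact: smooth_continuous].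
apply: continuous_sumR => i; apply: continuous_normR.
exact: (smooth_continuous (smooth_partial i se)).
Qed.

Lemma ramp_gradient_ge0 x : 0 <= h x.
Proof. by rewrite mulr_ge0 ?ramp_ge0 ?sumr_ge0. Qed.

Lemma ramp_gradient_integrable :
  (lebesgue_rV R n).-integrable setT (EFin \o h).
Proof.
have [se _ _] := te.
have ii i : (lebesgue_rV R n).-integrable setT (EFin \o (fun x => `|partial i eta x|)).
  exact/integrable_norm/test_function_integrable/(test_function_partial i te).
have isum : (lebesgue_rV R n).-integrable setT (EFin \o (fun x => \sum_i `|partial i eta x|)).
  exact: integrable_sum_fun.
have mr : measurable_fun setT (fun x => ramp s t (eta x)).
  by apply: measurable_ramp; exact/continuous_measurable_rV/smooth_continuous.
have r1 x : [set: 'rV[R]_n] x -> `|ramp s t (eta x)| <= 1.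
  by move=> _; rewrite ger0_norm ?ramp_ge0 ?ramp_le1.
have -> : h = (fun x => (\sum_i `|partial i eta x|) * ramp s t (eta x)).
  by apply/funext => x; rewrite mulrC.
exact: (integrable_Mbounded measurableT isum mr r1).
Qed.

(** Through each point of {t <= eta} and in each axis direction, the integral of
    ramp(eta) times the length of the gradient is at least (t - s) / 2 by [line_growth];
    divide by this number and apply [loomis_whitney]. *)
Lemma test_function_sobolev :
  ((t - s) / 2) ^+ n * (fine (lebesgue_rV R n [set x | t <= eta x])) ^+ n.-1 <=
  (\int[lebesgue_rV R n]_x h x) ^+ n.
Proof.
have [se ce eO] := te.
set E := [set x | t <= eta x].
set H := \int[lebesgue_rV R n]_x h x.
have H0 : 0 <= H by apply: Rintegral_ge0 => x _; exact: ramp_gradient_ge0.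
have [->|/set0P E0] := eqVneq E set0.
  by rewrite measure0 expr0n gtn_eqF -?subn1 ?subn_gt0// mulr0 exprn_ge0.
have t0 : 0 < t by exact: le_lt_trans st.
have cE : closed E.
  rewrite (_ : E = eta @^-1` [set y | t <= y]) //.
  apply: closed_comp; last exact: closed_ge.
  by move=> x _; exact: smooth_continuous.
have mE : measurable (E : set (borel_rV R n)).
  rewrite -(setCK E); apply: measurableC; apply: open_measurable_borel_rV.
  exact: closed_openC.
have Efin : lebesgue_rV R n E \is a fin_num.
  rewrite ge0_fin_numE ?measure_ge0//; apply: bounded_lebesgue_rV_lty.
  apply: sub_boundedr (compact_bounded ce).
  move=> P /= cP x /= tx; apply: cP; apply: subset_closure.
  by rewrite /= gt_eqF// (lt_le_trans t0).
set c := (t - s) / 2.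
have c0 : 0 < c by rewrite divr_gt0// subr_gt0.
have mh : measurable_fun setT (fun x : borel_rV R n => (c^-1 * h x)%:E).
  apply/measurable_EFinP; apply: measurable_funM => //.
  by apply: continuous_measurable_borel_rV; exact: continuous_ramp_gradient.
have h0 x : (0 <= (c^-1 * h x)%:E)%E.
  by rewrite lee_fin mulr_ge0 ?ramp_gradient_ge0// invr_ge0 ltW.
have [N N0 eN] := test_function_support_bounded te.
have lines (x : 'rV[R]_n) i : E x -> (1 <= \int[lebesgue_measure]_r (c^-1 * h (upd x i r))%:E)%E.
  move=> Ex.
  have mline : measurable_fun setT (fun r : R => (h (upd x i r))%:E).
    apply/measurable_EFinP; apply: continuous_measurable_fun => r.
    apply: continuous_comp; [exact: continuous_upd|exact: continuous_ramp_gradient].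
  under eq_integral do rewrite EFinM.
  rewrite ge0_integralZl_EFin//; last 2 first.
  - by move=> r _; rewrite lee_fin ramp_gradient_ge0.
  - by rewrite invr_ge0 ltW.
  have eN0 : eta (upd x i (- N)) = 0.
    apply/eqP/negP => /negP ex; apply: (eN (upd x i (- N)) i).
      by rewrite mxE eqxx normrN ger0_norm// ltW.
    exact: subset_closure.
  have xN : - N < x ord0 i.
    rewrite ltNge; apply/negP => xN.
    apply: (eN x i); last by apply: subset_closure; rewrite /= gt_eqF// (lt_le_trans t0).
    have x0 : x ord0 i <= 0 by rewrite (le_trans xN)// oppr_le0 ltW.
    by rewrite ler0_norm// lerNr.
  have := @line_growth R s t (fun r => eta (upd x i r)) (fun r => partial i eta (upd x i r)) N (x ord0 i).
  have cp : continuous (fun r => partial i eta (upd x i r)).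
    move=> r; apply: continuous_comp; first exact: continuous_upd.
    exact: (smooth_continuous (smooth_partial i se)).
  move=> /(_ s0 st _ cp eN0 xN); rewrite upd_self => /(_ _ Ex) lg.
  have {}lg := lg (fun r => is_derive_line (smooth_derivable se)).
  rewrite -(@mulVf _ c) ?gt_eqF// EFinM; apply: lee_wpmul2l.
    by rewrite lee_fin invr_ge0 ltW.
  apply: le_trans lg _; apply: ge0_le_integral => //.
  - by move=> r _; rewrite lee_fin mulr_ge0 ?ramp_ge0.
  - apply/measurable_EFinP; apply: continuous_measurable_fun => r.
    apply: cvgM; last by apply: cvg_norm; exact: cp.
    apply: continuous_comp; last exact: continuous_ramp.
    apply: continuous_comp; [exact: continuous_upd|exact: smooth_continuous].
  move=> r _; rewrite lee_fin ler_wpM2l ?ramp_ge0//.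
  by rewrite (bigD1 i)//= lerDl sumr_ge0.
have := loomis_whitney (ltnW n1) mE E0 mh h0 lines.
rewrite -lebesgue_rV_borel// -ge0_integral_lebesgue_rV//.
have -> : (\int[lebesgue_rV R n]_x (c^-1 * h x)%:E = (c^-1 * H)%:E)%E.
  under eq_integral do rewrite EFinM.
  rewrite (@integralZl _ _ _ _ _ measurableT _ ramp_gradient_integrable) EFinM.
  by rewrite /H /Rintegral fineK//; exact: integrable_fin_num ramp_gradient_integrable.
rewrite -(fineK Efin) -!EFin_expe lee_fin => LW.
rewrite mulrC -ler_pdivlMr ?exprn_gt0//; apply: le_trans LW _.
by rewrite exprMn exprVn mulrC.
Qed.

End sobolev_level.

(** * Functions orthogonal to all monomials *)

Section coordinate_moments.
Context (R : realType) (n : nat).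
Local Notation mu := (lebesgue_rV R n).
Implicit Types (D : set 'rV[R]_n) (g : 'rV[R]_n -> R).

Definition monomial (a : 'I_n -> nat) (x : 'rV[R]_n) : R := \prod_j x ord0 j ^+ a j.

Lemma monomialS (a : 'I_n -> nat) i k x :
  monomial (fun j => a j + (j == i) * k)%N x = monomial a x * x ord0 i ^+ k.
Proof.
rewrite /monomial; under eq_bigr do rewrite exprD.
rewrite big_split/=; congr (_ * _).
rewrite (bigD1 i)//= eqxx mul1n big1 ?mulr1// => j /negbTE->.
by rewrite mul0n expr0.
Qed.

Lemma smooth_monomial a : smooth (monomial a).
Proof.
apply: smooth_exprP; rewrite /monomial; elim: (index_enum _) => [|j r IH].
  by under eq_fun do rewrite big_nil; exact: smooth_const.
under eq_fun do rewrite big_cons; apply: smooth_mul => //.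
exact/smooth_base/smoothX/smooth_exprP/smooth_var.
Qed.

(** Bounds equal to -oo leave a coordinate free, which lets the moments be handled one
    coordinate at a time. *)
Definition octant (a : 'I_n -> \bar R) : set 'rV[R]_n :=
  [set x | forall j, (a j < (x ord0 j)%:E)%E].

Lemma octantI a b : octant a `&` octant b = octant (fun j => maxe (a j) (b j)).
Proof.
apply/seteqP; split => [x [ax bx] j|x abx].
  by rewrite gt_max ax bx.
by split => j; have := abx j; rewrite gt_max => /andP[].
Qed.

Lemma measurable_octant a : measurable (octant a : set (borel_rV R n)).
Proof.
apply: (@measurable_coord_box R n (fun j => [set r | (a j < r%:E)%E])) => j.
case: (a j) => [r| |].
- rewrite (_ : [set s | _] = `]r, +oo[%classic); first exact: measurable_itv.
  by apply/seteqP; split => s /=; rewrite in_itv/= andbT lte_fin.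
- rewrite [X in _.-measurable X](_ : _ = set0); first exact: measurable0.
  by apply/seteqP; split.
- rewrite [X in _.-measurable X](_ : _ = setT); first exact: measurableT.
  by apply/seteqP; split => // s _ /=; rewrite ltNyr.
Qed.

Lemma octant_generate :
  @measurable _ (borel_rV R n) = <<s [set octant a | a in setT] >>.
Proof.
apply/seteqP; split; last first.
  apply: smallest_sub; first exact: sigma_algebra_measurable.
  by move=> _ [a _ <-]; exact: measurable_octant.
apply: smallest_sub; first exact: smallest_sigma_algebra.
move=> A; rewrite -bigcup_seq => -[i _ [B mB <-]].
rewrite setTI.
pose T' : measurableType _ := g_sigma_algebraType ([set octant a | a in setT] : set (set 'rV[R]_n)).
have mc : measurable_fun setT ((fun x : 'rV[R]_n => x ord0 i) : T' -> R).
  apply: (measurability _ (RGenOInfty.measurableE R)) => //.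
  move=> _ [_ [r ->] <-]; rewrite setTI; apply: sub_sigma_algebra.
  exists (fun j => if j == i then r%:E else -oo%E) => //.
  apply/seteqP; split => x /=; rewrite in_itv/= andbT.
    by move=> /(_ i); rewrite eqxx lte_fin.
  by move=> rx j; case: eqP => [->|_]; rewrite ?lte_fin ?ltNyr.
by rewrite -[X in _ X]setTI; exact: mc.
Qed.

Lemma octant_setI_closed : setI_closed [set octant a | a in setT].
Proof.
by move=> _ _ [a _ <-] [b _ <-]; rewrite octantI; exists (fun j => maxe (a j) (b j)).
Qed.

Section vanishing_moments.
Variables (D : set 'rV[R]_n) (g : 'rV[R]_n -> R) (N : R).
Hypothesis mD : measurable D.
Hypothesis Dfin : (mu D < +oo)%E.
Hypothesis DN : forall x j, D x -> `|x ord0 j| <= N.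
Hypothesis gi : mu.-integrable D (EFin \o g).
Hypothesis moment0 : forall a, \int[mu]_(x in D) (g x * monomial a x) = 0.

Let meas_octant a : measurable (octant a).
Proof. by apply: borel_measurable_rV; exact: measurable_octant. Qed.

Let N0 (x : 'rV[R]_n) (j : 'I_n) : D x -> 0 <= N.
Proof. by move=> Dx; exact: le_trans (DN j Dx). Qed.

Let monomial_int a (E : set 'rV[R]_n) : measurable E -> E `<=` D ->
  mu.-integrable E (EFin \o (fun x => g x * monomial a x)).
Proof.
move=> mE ED; apply: (integrableS mD) => //.
apply: (@integrable_Mbounded _ _ _ _ _ _ _ (\prod_j N ^+ a j)) => //.
  exact/measurable_funTS/continuous_measurable_rV/smooth_continuous/smooth_monomial.
move=> x Dx; rewrite normr_prod; apply: ler_prod => j _.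
by rewrite normr_ge0/= normrX lerXn2r ?nnegrE ?DN// (N0 j Dx).
Qed.

(** Each application of [moments_ray] restricts one more coordinate to a half-line; the
    remaining monomials must be kept in the statement for the next application. *)
Lemma octant_moment0 (k : nat) a c : (forall j : 'I_n, (k <= j)%N -> c j = -oo%E) ->
  \int[mu]_(x in D `&` octant c) (g x * monomial a x) = 0.
Proof.
elim: k a c => [|k IH] a c ck.
  rewrite (_ : D `&` _ = D) ?moment0//; apply/setIidl => x _ j.
  by rewrite ck// ltNyr.
have [nk|kn] := leqP n k.
  by apply: IH => j kj; have := ltn_ord j; rewrite ltnNge (leq_trans nk).
pose i := Ordinal kn.
pose c' j := if j == i then -oo%E else c j.
have c'k (j : 'I_n) : (k <= j)%N -> c' j = -oo%E.
  rewrite /c'; case: eqP => // ji kj; apply: ck; rewrite ltn_neqAle kj andbT.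
  by apply/eqP => kj'; apply: ji; apply: val_inj.
have E : octant c = octant c' `&` [set x | (c i < (x ord0 i)%:E)%E].
  apply/seteqP; split => [x cx|x [c'x cx] j].
    by split => [j|]; [rewrite /c'; case: eqP => // _; rewrite ltNyr|exact: cx].
  by have := c'x j; rewrite /c'; case: eqP => // ->.
rewrite E setIA.
case: (c i) => [r| |].
- have mDc : measurable (D `&` octant c') by exact: measurableI.
  have mx : measurable_fun (D `&` octant c') (fun x : 'rV[R]_n => x ord0 i).
    exact/measurable_funTS/continuous_measurable_rV/coord_continuous.
  have xN x : (D `&` octant c') x -> `|x ord0 i| <= N by move=> [Dx _]; exact: DN.
  have gx0 m : \int[mu]_(x in D `&` octant c') (g x * monomial a x * x ord0 i ^+ m) = 0.
    under eq_Rintegral do rewrite -mulrA -monomialS.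
    exact: IH.
  exact: (moments_ray mDc (monomial_int a mDc (@subIsetl _ _ _)) mx xN gx0).
- rewrite [X in Rintegral _ X _](_ : _ = set0) ?Rintegral_set0//.
  by apply/seteqP; split => // x [_].
- rewrite [X in Rintegral _ X _](_ : _ = D `&` octant c') ?IH//.
  by apply/seteqP; split => [x []//|x Dx]; split => //=; rewrite ltNyr.
Qed.

(** Octants are stable under intersection and generate the Borel sets, so the monotone class
    argument applies. *)
Lemma borel_integral0 (B : set 'rV[R]_n) : measurable (B : set (borel_rV R n)) ->
  (\int[mu]_(x in D `&` B) (g x)%:E = 0)%E.
Proof.
have gi' (E : set 'rV[R]_n) : measurable E -> mu.-integrable (D `&` E) (EFin \o g).
  by move=> mE; apply: (integrableS mD) => //; exact: measurableI.
have D0 c : (\int[mu]_(x in D `&` octant c) (g x)%:E = 0)%E.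
  have := @octant_moment0 n (fun=> 0) c.
  under eq_Rintegral do rewrite /monomial big1 ?mulr1//.
  move=> H; rewrite -[LHS]fineK; last by apply: integrable_fin_num; [exact: measurableI|exact: gi'].
  by rewrite [fine _]H// => j nj; have := ltn_ord j; rewrite ltnNge nj.
have DT : (\int[mu]_(x in D) (g x)%:E = 0)%E.
  have := D0 (fun=> -oo%E); rewrite (_ : D `&` _ = D)//; apply/setIidl => x _ j.
  by rewrite ltNyr.
move=> mB; move: (mB); rewrite octant_generate.
pose P (S : set (borel_rV R n)) := (\int[mu]_(x in D `&` S) (g x)%:E = 0)%E.
apply: (@dynkin_induction _ (borel_rV R n) _ P octant_generate octant_setI_closed); rewrite /P.
- by rewrite setIT.
- by move=> _ [c _ <-]; exact: D0.
- move=> S mS S0.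
  have {}mS := borel_measurable_rV mS.
  have := DT; rewrite -{1}(setIT D) -(setUv S) setIUr integral_setU_EFin//; last 4 first.
  + exact: measurableI.
  + by apply: measurableI => //; exact: measurableC.
  + by rewrite -setIUr setUv setIT; apply/measurable_EFinP; exact: measurable_int gi.
  + by apply/disj_setPS => x [[_ Sx] [_]].
  by rewrite S0 add0e.
- move=> F mF tF F0; rewrite setI_bigcupr integral_bigcup//.
  + by rewrite eseries0.
  + exact: trivIset_setIl.
  + by move=> k; apply: measurableI => //; exact: borel_measurable_rV.
  + rewrite -setI_bigcupr; apply: gi'; apply: bigcupT_measurable => k.
    exact: borel_measurable_rV.
Qed.

Lemma vanishing_moments_ae0 : ae_eq mu D (EFin \o g) (cst 0%E).
Proof.
apply: integral_ae_eq => //; move=> E ED mE; rewrite integral0.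
(* The Borel hull B of the Lebesgue set E differs from it by a null set. *)
have [|B [mB EB BE]] := @lebesgue_rV_hull R n E.
  by apply: le_lt_trans Dfin; apply: le_outer_measure.
have mB' := borel_measurable_rV mB.
have mDB : measurable (D `&` B) by exact: measurableI.
have EDB : E `<=` D `&` B by move=> x Ex; split; [exact: ED|exact: EB].
have null : mu ((D `&` B) `\` E) = 0%E.
  apply/eqP; rewrite eq_le measure_ge0 andbT.
  apply: (@le_trans _ _ (mu (B `\` E))).
    by apply: le_measure; rewrite ?inE; [exact: measurableD|exact: measurableD|move=> x [[_ ?] ?]].
  have Efin : (mu E < +oo)%E by apply: le_lt_trans Dfin; apply: le_outer_measure.
  have Bfin : (mu B < +oo)%E by rewrite BE.
  have -> : mu (B `\` E) = (mu B - mu E)%E.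
    by rewrite (measureD mB' mE Bfin) (setIidr EB).
  by rewrite BE subee// ge0_fin_numE ?measure_ge0.
have := borel_integral0 mB.
rewrite (@negligible_integral _ _ _ _ (D `&` B) ((D `&` B) `\` E))//.
- by rewrite setDD (setIidr EDB).
- exact: measurableD.
- by apply: (integrableS mD).
Qed.

End vanishing_moments.
End coordinate_moments.

(** * Weak gradients and divergence-free fields *)

Section weak_gradients.
Context (R : realType) (n : nat).
Local Notation mu := (lebesgue_rV R n).
Implicit Types (Omega D : set 'rV[R]_n) (eta f : 'rV[R]_n -> R).

Lemma Rintegral_subset0 (A B : set 'rV[R]_n) f : A `<=` B ->
  (forall x, B x -> ~ A x -> f x = 0) ->
  \int[mu]_(x in B) f x = \int[mu]_(x in A) f x.
Proof.
move=> AB f0; rewrite Rintegral_mkcond [RHS]Rintegral_mkcond.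
apply: eq_Rintegral => x _; rewrite /patch.
case: (boolP (x \in A)) => [xA|xA].
  by rewrite mem_set//; apply: AB; rewrite inE in xA.
case: ifPn => // xB; apply: f0; first by rewrite inE in xB.
by move=> Ax; rewrite mem_set in xA.
Qed.

Lemma test_function_out eta x : ~ closure [set x | eta x != 0] x -> eta x = 0.
Proof. by move=> h; apply/eqP/negP => /negP ex; apply: h; exact: subset_closure. Qed.

Lemma test_function_mul_int Omega eta (D : set 'rV[R]_n) f : test_function Omega eta ->
  measurable D -> mu.-integrable D (EFin \o f) ->
  mu.-integrable D (EFin \o (fun x => f x * eta x)).
Proof.
move=> te mD fi; have [M _ etaM] := test_function_bounded te.
have me : measurable_fun D eta.
  by have [se _ _] := te; exact/measurable_funTS/continuous_measurable_rV/smooth_continuous.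
by apply: (integrable_Mbounded mD fi me (M := M)) => x _; exact: etaM.
Qed.

(** The integral of a partial derivative of the test function eta zeta is 0. *)
Lemma integral_by_parts Omega eta zeta i :
  test_function Omega eta -> test_function Omega zeta ->
  \int[mu]_x (eta x * partial i zeta x) = - \int[mu]_x (partial i eta x * zeta x).
Proof.
move=> te tz; have [se _ _] := te; have [sz _ _] := tz.
have := integral_partial0 i (test_functionM te sz).
rewrite partialM; [|by move=> x; exact: smooth_derivable..].
have i1 := test_function_mul_int (test_function_partial i tz) measurableT (test_function_integrable te).
have i2 := test_function_mul_int (test_function_partial i te) measurableT (test_function_integrable tz).
rewrite RintegralD// => /eqP; rewrite addr_eq0 => /eqP ->.
by congr (- _); apply: eq_Rintegral => x _; rewrite mulrC.
Qed.

Section uniqueness.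
Variables (Omega : set 'rV[R]_n) (phi eta : 'rV[R]_n -> R).
Variables (G F : 'rV[R]_n -> 'rV[R]_n).
Hypothesis wG : weak_gradient Omega phi G.
Hypothesis wF : weak_gradient Omega (phi \- eta) F.
Hypothesis te : test_function Omega eta.

Let D := closure [set x | eta x != 0].

Let DO : D `<=` Omega. Proof. by case: te. Qed.

Let cD : compact D. Proof. by case: te. Qed.

Let mD : measurable D.
Proof. by apply: closed_measurable_rV; exact: closed_closure. Qed.

Let Dfin : (mu D < +oo)%E.
Proof. exact/bounded_lebesgue_rV_lty/compact_bounded. Qed.

Let defect i x := F x ord0 i - G x ord0 i + partial i eta x.

Let phi_int : mu.-integrable D (EFin \o phi).
Proof. by have [H _ _] := wG; exact: H. Qed.

Let phieta_int : mu.-integrable D (EFin \o (phi \- eta)).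
Proof. by have [H _ _] := wF; exact: H. Qed.

Let G_int i : mu.-integrable D (EFin \o (fun x => G x ord0 i)).
Proof. by have [_ H _] := wG; exact: H. Qed.

Let F_int i : mu.-integrable D (EFin \o (fun x => F x ord0 i)).
Proof. by have [_ H _] := wF; exact: H. Qed.

Let eta_int i : mu.-integrable D (EFin \o partial i eta).
Proof.
apply: (integrableS measurableT) => //.
exact: test_function_integrable (test_function_partial i te).
Qed.

Let FG_int i : mu.-integrable D (EFin \o (fun x => F x ord0 i - G x ord0 i)).
Proof. exact: integrableB_fun. Qed.

Let defect_int i : mu.-integrable D (EFin \o defect i).
Proof. exact: integrableD_fun. Qed.

Let defect_test i (p : 'rV[R]_n -> R) : smooth p ->
  \int[mu]_(x in D) (defect i x * (eta x * p x)) = 0.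
Proof.
move=> sp; pose zeta x := eta x * p x.
have tz : test_function Omega zeta by exact: test_functionM.
have tp := test_function_partial i tz.
have zD x : ~ D x -> zeta x = 0.
  by move=> Dx; rewrite /zeta test_function_out// mul0r.
have pD x : ~ D x -> partial i zeta x = 0.
  move=> Dx; apply: partial_notin_support => zx; apply: Dx.
  by move: x zx; apply: closure_subset => x /=; apply: contra => /eqP ex; rewrite /zeta ex mul0r.
have [_ _ /(_ _ tz i)] := wG; have [_ _ /(_ _ tz i)] := wF.
do 4 (rewrite (Rintegral_subset0 DO); last by move=> x _ Dx; rewrite ?pD ?zD ?mulr0//).
have := integral_by_parts i te tz.
do 2 (rewrite (@Rintegral_subset0 D setT)//; last by move=> x _ Dx; rewrite ?pD ?zD ?mulr0//).
have e_int : mu.-integrable D (EFin \o eta).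
  by apply: (integrableS measurableT) => //; exact: test_function_integrable te.
move=> E1 E2 E3.
have i1 := test_function_mul_int tp mD phi_int.
have i2 := test_function_mul_int tp mD e_int.
have i3 := test_function_mul_int tz mD (F_int i).
have i4 := test_function_mul_int tz mD (G_int i).
have i5 := test_function_mul_int tz mD (eta_int i).
have i6 := test_function_mul_int tz mD (FG_int i).
move: E2; under eq_Rintegral do rewrite mulrBl.
rewrite RintegralB// E1 E3 => E4.
under eq_Rintegral do rewrite -/(zeta _) mulrDl.
rewrite RintegralD//; under eq_Rintegral do rewrite mulrBl.
rewrite RintegralB//; lra.
Qed.

(** Uniqueness of weak gradients where eta is nonzero. Testing against eta times a monomial
    shows that (F - G + grad eta) eta has vanishing moments; the support of eta
    is compact, so the coordinates are bounded there. *)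
Lemma weak_gradient_test : {ae mu, forall x, Omega x -> eta x != 0 ->
  forall i, G x ord0 i = F x ord0 i + partial i eta x}.
Proof.
have [N N0 eN] := test_function_support_bounded te.
have DN (x : 'rV[R]_n) j : D x -> `|x ord0 j| <= N.
  by move=> Dx; rewrite leNgt; apply/negP => /ltW /eN; exact.
have key i : ae_eq mu D (EFin \o (fun x => defect i x * eta x)) (cst 0%E).
  apply: (vanishing_moments_ae0 mD Dfin DN).
    exact: test_function_mul_int te mD (defect_int i).
  move=> a; under eq_Rintegral do rewrite -mulrA.
  exact/defect_test/smooth_monomial.
have H : {ae mu, forall x, forall i, D x -> ((defect i x * eta x)%:E = 0)%E}.
  by apply: filter_forall => i; exact: key.
apply: filterS H => x Hx _ ex i.
have Dx : D x by exact: subset_closure.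
have [] := Hx i Dx.
move=> /eqP; rewrite mulf_eq0 (negbTE ex) orbF /defect => /eqP h.
by move: h; lra.
Qed.

End uniqueness.

Section div_free.
Variables (Omega : set 'rV[R]_n) (xi : 'rV[R]_n -> 'rV[R]_n).
Hypothesis mO : measurable Omega.
Hypothesis xi_int : forall i, mu.-integrable Omega (EFin \o (fun x => xi x ord0 i)).
Hypothesis xi_div : weakly_div_free Omega xi.
Variable eta : 'rV[R]_n -> R.
Hypothesis te : test_function Omega eta.

Lemma dotv_gradient_int :
  mu.-integrable Omega (EFin \o (fun x => dotv (xi x) (gradient eta x))).
Proof.
apply: integrable_sum_fun => // i.
under eq_fun do rewrite mxE.
exact: test_function_mul_int (test_function_partial i te) mO (xi_int i).
Qed.

(** The powers of eta are test functions with gradient (k+1) eta^k grad eta, so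
    <xi, grad eta> is orthogonal to every power of eta, hence to every ramp of eta. *)
Lemma div_free_ramp (s t : R) : s < t ->
  \int[mu]_(x in Omega) (dotv (xi x) (gradient eta x) * ramp s t (eta x)) = 0.
Proof.
move=> st; have [se _ _] := te; have [M M0 etaM] := test_function_bounded te.
have me : measurable_fun Omega eta.
  exact/measurable_funTS/continuous_measurable_rV/smooth_continuous.
apply: (moments_ramp mO dotv_gradient_int me (fun x _ => etaM x) _ st).
move=> k; have := xi_div (test_functionX k te).
have E x : dotv (xi x) (gradient (fun x => eta x ^+ k.+1) x) =
    k.+1%:R * (dotv (xi x) (gradient eta x) * eta x ^+ k).
  rewrite /dotv mulr_suml mulr_sumr; apply: eq_bigr => i _.
  by rewrite !mxE partialX//; ring.
under eq_Rintegral do rewrite E.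
rewrite RintegralZl//; last first.
  apply: (integrable_Mbounded (M := M ^+ k) mO dotv_gradient_int).
    exact/measurable_funTS/continuous_measurable_rV/smooth_continuous/smoothX.
  by move=> x _; rewrite normrX lerXn2r.
by move=> /eqP; rewrite mulf_eq0 pnatr_eq0/= => /eqP.
Qed.

End div_free.
End weak_gradients.

(** * Comparison of integrals and Holder's inequality on a set *)

Section integral_inequalities.
Context d (T : measurableType d) (R : realType).
Variable mu : {measure set T -> \bar R}.
Implicit Types (D U : set T) (f g : T -> R) (p : \bar R).

Lemma Rintegral_sum_fun D (I : finType) (F : I -> T -> R) : measurable D ->
  (forall i, mu.-integrable D (EFin \o F i)) ->
  \int[mu]_(x in D) (\sum_i F i x) = \sum_i \int[mu]_(x in D) F i x.
Proof.
move=> mD Fi; pose S (r : seq I) x := \sum_(i <- r) F i x.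
have Si r : mu.-integrable D (EFin \o S r) /\
    \int[mu]_(x in D) S r x = \sum_(i <- r) \int[mu]_(x in D) F i x.
  elim: r => [|i r [IH1 IH2]].
    rewrite /S big_nil; under eq_fun do rewrite big_nil.
    split; first exact: integrable0.
    by rewrite Rintegral_cst// mul0r.
  have SE x : S (i :: r) x = F i x + S r x by rewrite /S big_cons.
  split; first by rewrite (funext SE : S _ = _); exact: integrableD_fun.
  by under eq_Rintegral do rewrite SE; rewrite RintegralD// big_cons IH2.
exact: (Si _).2.
Qed.

Lemma le_Rintegral_ae D f g : measurable D ->
  mu.-integrable D (EFin \o f) -> mu.-integrable D (EFin \o g) ->
  {ae mu, forall x, D x -> f x <= g x} ->
  \int[mu]_(x in D) f x <= \int[mu]_(x in D) g x.
Proof.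
(* The maximum is above f everywhere and equal to g almost everywhere. *)
move=> mD fi gi fg; pose h x := Num.max (f x) (g x).
have mf : measurable_fun D f by apply/measurable_EFinP; exact: measurable_int fi.
have mg : measurable_fun D g by apply/measurable_EFinP; exact: measurable_int gi.
have mh : measurable_fun D h by exact: measurable_maxr.
have hi : mu.-integrable D (EFin \o h).
  have := integrableD_fun mD (integrable_norm fi) (integrable_norm gi).
  apply: le_integrable => //; first exact/measurable_EFinP.
  move=> x _; rewrite /= lee_fin [leRHS]ger0_norm ?addr_ge0//.
  by rewrite /h maxEle; case: ifP => _; [rewrite lerDr|rewrite lerDl].
apply: (@le_trans _ _ (\int[mu]_(x in D) h x)).
  by apply: le_Rintegral => // x _; rewrite le_max lexx.
rewrite le_eqVlt; apply/orP; left; apply/eqP; congr fine.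
apply: ae_eq_integral => //; [exact/measurable_EFinP|exact/measurable_EFinP|].
by apply: filterS fg => x + Dx => /(_ Dx) h1; congr EFin; exact/max_idPr.
Qed.

(** Holder's inequality against the indicator of U, the endpoints p = 1 and p = +oo being
    treated apart. The exponent 1 - fine p^-1 covers the three cases uniformly. *)
Lemma holder_set_ereal f p U : measurable U -> (mu U < +oo)%E -> (1 <= p)%E ->
  f \in Lfun mu p ->
  (\int[mu]_(x in U) (`|f x|)%:E <=
    'N[mu]_p[EFin \o f] * (mu U) `^ (1 - fine p^-1)%R)%E.
Proof.
move=> mU Ufin p1 /andP[]; rewrite !inE/= => mf nf.
have mU0 : (0 <= mu U)%E by [].
have mfU : measurable_fun U (fun x => (`|f x|)%:E).
  by apply/measurable_EFinP/measurable_funTS; exact: measurableT_comp.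
case: p p1 nf => [p| |//] p1 nf.
  have p0 : 0 < p by rewrite lee_fin in p1; exact: lt_le_trans p1.
  rewrite inver gt_eqF//=.
  move: p1; rewrite lee_fin le_eqVlt => /predU1P[p1|p1].
    rewrite -p1 invr1 subrr poweRe0 mule1 Lnorm1.
    apply: ge0_subset_integral => //.
    by apply/measurable_EFinP; exact: measurableT_comp.
  pose q := p / (p - 1).
  have p10 : 0 < p - 1 by rewrite subr_gt0.
  have q0 : 0 < q by rewrite divr_gt0.
  have pq : p^-1 + q^-1 = 1.
    by rewrite /q invf_div; field; rewrite gt_eqF.
  have mI : measurable_fun setT (\1_U : T -> R) by exact: measurable_indic.
  have := hoelder mu mf mI p0 q0 pq.
  rewrite Lnorm1 (_ : (\int[mu]_x _)%E = (\int[mu]_(x in U) (`|f x|)%:E)%E); last first.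
    rewrite [RHS]integral_mkcond; apply: eq_integral => x _.
    rewrite /patch /= indicE; case: ifPn => _; first by rewrite mulr1.
    by rewrite mulr0 normr0.
  move=> /le_trans; apply; apply: lee_wpmul2l; first exact: Lnorm_ge0.
  rewrite (_ : (1 - p^-1)%R = q^-1); last by rewrite -pq; ring.
  rewrite unlock (_ : (\int[mu]_x _)%E = mu U)//.
  rewrite -[in RHS](setIT U) -integral_indic//.
  apply: eq_integral => x _; rewrite /= indicE; case: (x \in U).
    by rewrite normr1 powR1.
  by rewrite normr0 powR0// gt_eqF.
rewrite invey/= subr0 poweRe1//.
have fN : {ae mu, forall x, ((`|f x|)%:E <= 'N[mu]_(+oo)[EFin \o f])%E}.
  rewrite unlock; case: ifPn => [_|]; first exact: (ess_sup_ge mu (abse \o (EFin \o f))).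
  rewrite -leNgt => mu0; exists setT; split => //.
  by apply/eqP; rewrite eq_le mu0 measure_ge0.
rewrite -integral_cst//; apply: ae_ge0_le_integral => //.
- by move=> x _; exact: Lnorm_ge0.
- by apply: filterS fN => x h _.
Qed.

Lemma holder_set f p U : measurable U -> (mu U < +oo)%E -> (1 <= p)%E ->
  f \in Lfun mu p ->
  mu.-integrable U (EFin \o f) /\
  \int[mu]_(x in U) `|f x| <=
    fine ('N[mu]_p[EFin \o f])%E * (fine (mu U)) `^ (1 - fine p^-1).
Proof.
move=> mU Ufin p1 fp; have := holder_set_ereal mU Ufin p1 fp.
have Ufn : mu U \is a fin_num by rewrite ge0_fin_numE.
move: (fp) => /andP[]; rewrite !inE/= => mf nf.
have Nfn : ('N[mu]_p[EFin \o f])%E \is a fin_num by rewrite ge0_fin_numE// Lnorm_ge0.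
rewrite -[X in (_ <= X * _)%E](fineK Nfn) -[X in (_ <= _ * X `^ _)%E](fineK Ufn) poweR_EFin -EFinM => H.
have fi : mu.-integrable U (EFin \o f).
  apply/integrableP; split; first exact/measurable_EFinP/measurable_funTS.
  exact: le_lt_trans H (ltry _).
split => //; rewrite -lee_fin /Rintegral fineK//.
exact: integrable_fin_num (integrable_norm fi).
Qed.

End integral_inequalities.

(** * The level estimate for a test function *)

Section pointwise.
Context (R : realType) (n : nat).
Implicit Types x y : 'rV[R]_n.

Lemma euclid_norm_ge0 x : 0 <= euclid_norm x.
Proof. exact: sqrtr_ge0. Qed.

Lemma coord_le_euclid_norm x i : `|x ord0 i| <= euclid_norm x.
Proof.
rewrite -sqrtr_sqr ler_wsqrtr// /dotv (bigD1 i)//= expr2 lerDl.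
by apply: sumr_ge0 => j _; rewrite -expr2 sqr_ge0.
Qed.

Lemma dotvDl x y z : dotv (x + y) z = dotv x z + dotv y z.
Proof. by rewrite /dotv -big_split/=; apply: eq_bigr => i _; rewrite mxE mulrDl. Qed.

Lemma dotvC x y : dotv x y = dotv y x.
Proof. by apply: eq_bigr => i _; rewrite mulrC. Qed.

Lemma dotv_le_sum x y : dotv x y <= \sum_i `|x ord0 i * y ord0 i|.
Proof. by apply: ler_sum => i _; exact: ler_norm. Qed.

Hypothesis n1 : (1 < n)%N.

(** If the coefficient k is 0 then so is the vector x, and the scalar product with it. *)
Lemma distortion_factor_ge0 (k a : R) x y : 0 <= k -> 0 <= a ->
  euclid_norm x ^+ n <= k * (dotv x y + a) -> 0 <= dotv x y + a.
Proof.
rewrite le_eqVlt => /predU1P[<-|k0] a0 H.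
  have e0 : euclid_norm x = 0.
    have : euclid_norm x ^+ n == 0.
      by rewrite eq_le exprn_ge0 ?euclid_norm_ge0// andbT (le_trans H)// mul0r.
    by rewrite expf_eq0 (ltnW n1) => /eqP.
  rewrite /dotv big1 ?add0r// => i _.
  have := coord_le_euclid_norm x i; rewrite e0 normr_le0 => /eqP ->.
  by rewrite mul0r.
by rewrite -(pmulr_rge0 _ k0) (le_trans _ H)// exprn_ge0// euclid_norm_ge0.
Qed.

(** A weighted inequality of means with a crude constant: if a exceeded the sum, then a^n
    would exceed the product of the n factors l k, m b and v (taken n - 2 times), which
    is k b. Being linear in b, the conclusion can be integrated even though b is a
    sum involving a scalar product of no definite sign. *)
Lemma le_sum_of_expr_le (a k b l m v : R) : 0 <= a -> 0 <= k -> 0 <= b ->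
  0 < l -> 0 < m -> 0 < v -> l * m * v ^+ (n - 2) = 1 -> a ^+ n <= k * b ->
  a <= l * k + m * b + v.
Proof.
move=> a0 k0 b0 l0 m0 v0 lmv akb; rewrite leNgt; apply/negP.
set s := l * k + m * b + v => sa.
have lk0 : 0 <= l * k by rewrite mulr_ge0// ltW.
have mb0 : 0 <= m * b by rewrite mulr_ge0// ltW.
have s0 : 0 < s by rewrite ltr_wpDl// addr_ge0.
have : s ^+ n < a ^+ n by rewrite ltrXn2r// ?(ltW s0)// gtn_eqF// ltnW.
rewrite ltNge => /negP; apply; apply: le_trans akb _.
have -> : k * b = l * k * (m * b) * v ^+ (n - 2).
  by rewrite -[LHS]mul1r -lmv; ring.
rewrite -[in leRHS](subnKC n1) exprD expr2.
apply: ler_pM; [exact: mulr_ge0|by rewrite exprn_ge0// ltW| |].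
  by apply: ler_pM => //; rewrite /s; lra.
by rewrite lerXn2r ?nnegrE ?(ltW v0) ?(ltW s0)//; rewrite /s; lra.
Qed.

End pointwise.

Section level_estimate.
Context (R : realType) (n : nat) (n1 : (1 < n)%N).
Local Notation mu := (lebesgue_rV R n).
Variables (Omega : set 'rV[R]_n) (K A eta : 'rV[R]_n -> R).
Variables (G F xi : 'rV[R]_n -> 'rV[R]_n).
Hypothesis mO : measurable Omega.
Hypothesis Ofin : (mu Omega < +oo)%E.
Hypothesis te : test_function Omega eta.
Hypothesis xi_int : forall i, mu.-integrable Omega (EFin \o (fun x => xi x ord0 i)).
Hypothesis xi_div : weakly_div_free Omega xi.
Hypothesis K_int : mu.-integrable Omega (EFin \o K).
Hypothesis K0 : forall x, Omega x -> 0 <= K x.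
Hypothesis A_int : mu.-integrable Omega (EFin \o A).
Hypothesis A0 : forall x, Omega x -> 0 <= A x.
Hypothesis F_int : forall i, mu.-integrable Omega (EFin \o (fun x => F x ord0 i)).
Hypothesis Fxi_int : forall i,
  mu.-integrable Omega (EFin \o (fun x => F x ord0 i * xi x ord0 i)).
Hypothesis distortion : {ae mu, forall x, Omega x ->
  euclid_norm (G x) ^+ n <= K x * (dotv (G x) (xi x) + A x)}.
Hypothesis GF : {ae mu, forall x, Omega x -> eta x != 0 ->
  forall i, G x ord0 i = F x ord0 i + partial i eta x}.
Variables (l m v s t : R).
Hypotheses (l0 : 0 < l) (m0 : 0 < m) (v0 : 0 < v).
Hypothesis lmv : l * m * v ^+ (n - 2) = 1.
Hypotheses (s0 : 0 <= s) (st : s < t).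

Let r (x : 'rV[R]_n) : R := ramp s t (eta x).
Let sF (x : 'rV[R]_n) : R := \sum_i `|F x ord0 i|.
Let sFxi (x : 'rV[R]_n) : R := \sum_i `|F x ord0 i * xi x ord0 i|.
Let U := Omega `&` [set x | s < eta x].

Let r0 x : 0 <= r x. Proof. exact: ramp_ge0. Qed.
Let r1 x : r x <= 1. Proof. exact: ramp_le1. Qed.

Let mr D : measurable_fun D r.
Proof.
have [se _ _] := te; apply: measurable_ramp.
exact/measurable_funTS/continuous_measurable_rV/smooth_continuous.
Qed.

Let mU : measurable U.
Proof.
have [se _ _] := te; apply: measurableI => //; apply: open_measurable_rV.
rewrite (_ : [set x | _] = eta @^-1` [set y | s < y])//.
apply: open_comp; last exact: open_gt.
by move=> x _; exact: smooth_continuous.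
Qed.

Let r_int (f : 'rV[R]_n -> R) : mu.-integrable Omega (EFin \o f) ->
  mu.-integrable Omega (EFin \o (fun x => f x * r x)).
Proof.
move=> fi; have rb x : Omega x -> `|r x| <= 1 by rewrite ger0_norm.
exact: (integrable_Mbounded mO fi (@mr Omega) rb).
Qed.

Let le_r_int (f : 'rV[R]_n -> R) : mu.-integrable Omega (EFin \o f) ->
  (forall x, Omega x -> 0 <= f x) ->
  \int[mu]_(x in Omega) (f x * r x) <= \int[mu]_(x in U) f x.
Proof.
move=> fi f0; rewrite (_ : U = Omega `&` U); last by rewrite /U setIA setIid.
rewrite Rintegral_mkcondr; apply: le_Rintegral => //; first exact: r_int.
  have := (integrable_restrict mu mU mO (EFin \o f)).1.
  rewrite restrict_EFin; apply; apply: (integrableS mO) => //.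
  by apply: measurableI.
move=> x Ox; rewrite /patch; case: ifPn => [_|xU].
  by rewrite ler_piMr ?f0.
have es : eta x <= s.
  by rewrite leNgt; apply/negP => se; move: xU; rewrite mem_set.
by rewrite /r ramp_low// mulr0.
Qed.

(** The term dotv (xi x) (gradient eta x) * r x is kept as it stands, since its integral
    vanishes by [div_free_ramp]; every other error is estimated by absolute values. *)
Lemma pointwise_level_estimate : {ae mu, forall x, Omega x ->
  r x * \sum_i `|partial i eta x| <= sF x + n%:R * (l * (K x * r x) +
    m * (sFxi x + dotv (xi x) (gradient eta x) * r x + A x * r x) + v * r x)}.
Proof.
apply: filterS2 distortion GF => x dis gf Ox.
have sF0 : 0 <= sF x by apply: sumr_ge0.
have sFxi0 : 0 <= sFxi x by apply: sumr_ge0.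
have n0 : 0 <= n%:R :> R by [].
have [es|se] := leP (eta x) s.
  have -> : r x = 0 by rewrite /r ramp_low.
  by rewrite !(mul0r, mulr0, addr0, add0r) addr_ge0// mulr_ge0// mulr_ge0// ltW.
(* Above the height s >= 0 the function eta is nonzero, so that G = F + grad eta at x. *)
have ex : eta x != 0 by rewrite gt_eqF// (le_lt_trans s0).
have {}gf := gf Ox ex; have {}dis := dis Ox.
set a := euclid_norm (G x) in dis; set b := dotv (G x) (xi x) + A x in dis.
have b0 : 0 <= b by exact: distortion_factor_ge0 (K0 Ox) (A0 Ox) dis.
have aB : a <= l * K x + m * b + v.
  exact: (le_sum_of_expr_le n1 (euclid_norm_ge0 _) (K0 Ox) b0 l0 m0 v0 lmv dis).
have bB : b <= sFxi x + dotv (xi x) (gradient eta x) + A x.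
  rewrite /b lerD2r.
  have -> : G x = F x + gradient eta x.
    by apply/rowP => i; rewrite !mxE -gf; congr (_ _); rewrite ord1.
  rewrite dotvDl [dotv (gradient _ _) _]dotvC lerD2r; exact: dotv_le_sum.
have pB : \sum_i `|partial i eta x| <= n%:R * a + sF x.
  have -> : n%:R * a + sF x = \sum_(i < n) (a + `|F x ord0 i|).
    by rewrite big_split/= sumr_const card_ord mulr_natl.
  apply: ler_sum => i _; have -> : partial i eta x = G x ord0 i - F x ord0 i.
    by rewrite gf addrAC subrr add0r.
  by rewrite (le_trans (ler_normB _ _))// lerD2r; exact: coord_le_euclid_norm.
have mbB : m * b <= m * (sFxi x + dotv (xi x) (gradient eta x) + A x) by rewrite ler_pM2l.
have H : \sum_i `|partial i eta x| <= n%:R * (l * K x +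
    m * (sFxi x + dotv (xi x) (gradient eta x) + A x) + v) + sF x.
  apply: le_trans pB _; rewrite lerD2r ler_wpM2l//; lra.
apply: (le_trans (ler_wpM2l (r0 x) H)).
have rF : r x * sF x <= sF x by rewrite ler_piMl.
have rFxi : m * (r x * sFxi x) <= m * sFxi x by rewrite ler_pM2l// ler_piMl.
have rFxi' : n%:R * (m * (r x * sFxi x)) <= n%:R * (m * sFxi x) by rewrite ler_wpM2l.
rewrite mulrDr addrC; apply: lerD => //.
rewrite mulrCA; rewrite ler_wpM2l//.
have rFxi2 : m * (r x * sFxi x) <= m * sFxi x by [].
move: (dotv _ _) => dx.
rewrite (_ : r x * _ = l * (K x * r x) + m * (r x * sFxi x + dx * r x + A x * r x) + v * r x).
  by rewrite lerD2r lerD2l ler_pM2l// -!addrA lerD2r ler_piMl.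
by ring.
Qed.

(** The pointwise inequality is integrated and inserted in [test_function_sobolev]. The set
    {t <= eta} lies in Omega because t is positive. *)
Lemma level_estimate :
  ((t - s) / 2) ^+ n * (fine (mu [set x | t <= eta x])) ^+ n.-1 <=
  (\int[mu]_(x in Omega) sF x + n%:R * (l * \int[mu]_(x in U) K x +
    m * (\int[mu]_(x in Omega) sFxi x + \int[mu]_(x in U) A x) +
    v * fine (mu U))) ^+ n.
Proof.
have := test_function_sobolev n1 te s0 st.
move=> /le_trans; apply.
have sF_int : mu.-integrable Omega (EFin \o sF).
  by apply: integrable_sum_fun => // i; exact: integrable_norm.
have sFxi_int : mu.-integrable Omega (EFin \o sFxi).
  by apply: integrable_sum_fun => // i; exact: integrable_norm.
have Kr_int := r_int K_int.
have Ar_int := r_int A_int.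
have dr_int := r_int (dotv_gradient_int mO xi_int te).
have one_int : mu.-integrable Omega (EFin \o (fun=> 1 : R)).
  apply: measurable_bounded_integrable => //.
  by exists 1; split; [exact: num_real|move=> y y1 x _; rewrite normr1 ltW].
have rr_int : mu.-integrable Omega (EFin \o r).
  by have := r_int one_int; under eq_fun do rewrite mul1r.
have D0 := div_free_ramp mO xi_int xi_div te st.
have i1 := integrableD_fun mO sFxi_int dr_int.
have i2 := integrableZl_fun m mO (integrableD_fun mO i1 Ar_int).
have i3 := integrableZl_fun l mO Kr_int.
have i4 := integrableZl_fun v mO rr_int.
have i5 := integrableD_fun mO (integrableD_fun mO i3 i2) i4.
have i6 := integrableZl_fun n%:R mO i5.
have H : \int[mu]_x (ramp s t (eta x) * \sum_i `|partial i eta x|) <=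
    \int[mu]_(x in Omega) sF x + n%:R * (l * \int[mu]_(x in U) K x +
    m * (\int[mu]_(x in Omega) sFxi x + \int[mu]_(x in U) A x) +
    v * fine (mu U)).
  rewrite (@Rintegral_subset0 R n Omega)//; last first.
    move=> x _ Ox; rewrite test_function_out ?ramp_low ?mul0r// => ex.
    by apply: Ox; case: te => _ _; exact.
  apply: (@le_trans _ _ (\int[mu]_(x in Omega) (sF x + n%:R * (l * (K x * r x) +
    m * (sFxi x + dotv (xi x) (gradient eta x) * r x + A x * r x) + v * r x)))).
    apply: le_Rintegral_ae => //.
    - apply: (integrableS measurableT) => //.
      exact: (ramp_gradient_integrable te st).
    - exact: integrableD_fun.
    - exact: pointwise_level_estimate.
  rewrite RintegralD// lerD2l RintegralZl// ler_wpM2l// RintegralD//; last exact: integrableD_fun.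
  rewrite RintegralD// RintegralZl// [X in _ + X + _]RintegralZl//; last exact: integrableD_fun.
  rewrite [X in _ + X]RintegralZl// RintegralD// RintegralD// D0 addr0.
  apply: lerD; last first.
    rewrite ler_pM2l//; have := le_r_int one_int (fun _ _ => ler01).
    under eq_Rintegral do rewrite mul1r.
    by rewrite Rintegral_cst// mul1r.
  apply: lerD; first by rewrite ler_pM2l// le_r_int.
  by rewrite ler_pM2l// lerD2l le_r_int.
have h0 : 0 <= \int[mu]_x (ramp s t (eta x) * \sum_i `|partial i eta x|).
  by apply: Rintegral_ge0 => x _; rewrite mulr_ge0 ?ramp_ge0 ?sumr_ge0.
by apply: lerXn2r => //; rewrite nnegrE (le_trans h0).
Qed.

End level_estimate.

(** * Lebesgue norms on a domain of finite measure *)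

Section Lp_on_domain.
Context (R : realType) (n : nat).
Local Notation mu := (lebesgue_rV R n).
Variable Omega : set 'rV[R]_n.
Hypotheses (mO : measurable Omega) (Ofin : (mu Omega < +oo)%E).
Implicit Types (f g : 'rV[R]_n -> R) (F : 'rV[R]_n -> 'rV[R]_n) (p : \bar R).

Lemma holder_subset f p U : (1 <= p)%E -> in_Lp Omega p f -> measurable U ->
  U `<=` Omega ->
  mu.-integrable U (EFin \o f) /\
  \int[mu]_(x in U) `|f x| <=
    fine (Lp_norm Omega p f) * (fine (mu U)) `^ (1 - fine p^-1).
Proof.
move=> p1 fp mU UO.
have Ufin : (mu U < +oo)%E by apply: le_lt_trans Ofin; exact: le_outer_measure.
have [fi fle] := holder_set mU Ufin p1 fp.
have fE : {in U, f \_ Omega =1 f}.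
  by move=> x; rewrite inE => Ux; rewrite patchT// inE; exact: UO.
split; first by apply: eq_integrable fi => // x xU /=; rewrite fE.
by move: fle; under eq_Rintegral do [rewrite fE//].
Qed.

Lemma in_Lp_measurable f p : in_Lp Omega p f -> measurable_fun Omega f.
Proof. by move=> /andP[]; rewrite inE/= => /(measurable_restrictT _ mO). Qed.

Lemma in_Lp_of_norm_lt f p (e : R) : measurable_fun Omega f ->
  (Lp_norm Omega p f < e%:E)%E ->
  in_Lp Omega p f /\ 0 <= fine (Lp_norm Omega p f) <= e.
Proof.
move=> mf fe; have N0 : (0 <= Lp_norm Omega p f)%E by exact: Lnorm_ge0.
have Nfin : Lp_norm Omega p f \is a fin_num.
  by rewrite ge0_fin_numE// (lt_trans fe) ?ltry.
split.
  apply/andP; split; rewrite inE/=; first exact: (measurable_restrictT f mO).1.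
  exact: lt_trans fe (ltry _).
by rewrite fine_ge0//= -lee_fin fineK// ltW.
Qed.

Lemma measurable_euclid_norm F :
  (forall i, measurable_fun Omega (fun x => F x ord0 i)) ->
  measurable_fun Omega (@euclid_norm R n \o F).
Proof.
move=> mF; apply: (measurableT_comp (continuous_measurable_fun (@sqrt_continuous R))).
rewrite /dotv; apply: measurable_sum => i; exact: measurable_funM.
Qed.

Lemma holder_product f g (p q : R) : 1 < p -> p^-1 + q^-1 = 1 -> 0 < q ->
  in_Lp Omega p%:E f -> in_Lp Omega q%:E g ->
  mu.-integrable Omega (EFin \o (fun x => f x * g x)) /\
  \int[mu]_(x in Omega) `|f x * g x| <=
    fine (Lp_norm Omega p%:E f) * fine (Lp_norm Omega q%:E g).
Proof.
move=> p1 pq q0 fp gq.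
have p0 : 0 < p by exact: lt_trans p1.
have mf := in_Lp_measurable fp; have mg := in_Lp_measurable gq.
have /andP[] := fp; have /andP[] := gq; rewrite !inE/= => mg' ng mf' nf.
have := hoelder mu mf' mg' p0 q0 pq.
rewrite Lnorm1 (_ : (\int[mu]_x _)%E = (\int[mu]_(x in Omega) (`|f x * g x|)%:E)%E); last first.
  rewrite [RHS]integral_mkcond; apply: eq_integral => x _.
  by rewrite /patch /=; case: ifPn => _ //; rewrite mulr0 normr0.
have Nf : (Lp_norm Omega p%:E f) \is a fin_num.
  by rewrite ge0_fin_numE//; exact: Lnorm_ge0.
have Ng : (Lp_norm Omega q%:E g) \is a fin_num.
  by rewrite ge0_fin_numE//; exact: Lnorm_ge0.
rewrite -/(Lp_norm Omega p%:E f) -/(Lp_norm Omega q%:E g) -(fineK Nf) -(fineK Ng) -EFinM => H.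
have fgi : mu.-integrable Omega (EFin \o (fun x => f x * g x)).
  apply/integrableP; split; first exact/measurable_EFinP/measurable_funM.
  exact: le_lt_trans H (ltry _).
split => //; rewrite -lee_fin /Rintegral.
by rewrite (fineK (integrable_fin_num mO (integrable_norm fgi))).
Qed.

Lemma chebyshev f (a : R) : 0 < a -> mu.-integrable Omega (EFin \o f) ->
  fine (mu (Omega `&` [set x | a <= `|f x|])) <= (\int[mu]_(x in Omega) `|f x|) / a.
Proof.
move=> a0 fi; have mf : measurable_fun Omega (EFin \o f) by exact: measurable_int fi.
have := le_integral_abse mu mO mf a0.
rewrite (_ : [set x | (_ <= _)%E] = [set x | a <= `|f x|]); last first.
  by apply/seteqP; split => x /=; rewrite lee_fin.
set W := Omega `&` _ => H.
have Wlt : (mu W < +oo)%E.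
  by apply: le_lt_trans Ofin; apply: le_outer_measure => x [].
have Wfin : mu W \is a fin_num by rewrite ge0_fin_numE.
rewrite ler_pdivlMr// -lee_fin EFinM (fineK Wfin) muleC /Rintegral.
by rewrite (fineK (integrable_fin_num mO (integrable_norm fi))).
Qed.

End Lp_on_domain.

(** Lets finitely many error terms be made small with one choice of e. *)
Lemma small_factor (R : realType) (c b : R) : 0 <= c -> 0 < b ->
  exists2 e0 : R, 0 < e0 & forall e, 0 <= e -> e <= e0 -> e * c <= b.
Proof.
move=> c0 b0; have c1 : 0 < c + 1 by rewrite ltr_wpDl.
exists (b / (c + 1)); first by rewrite divr_gt0.
move=> e e0; rewrite ler_pdivlMr// => H; apply: le_trans H.
by rewrite ler_wpM2l// lerDl.
Qed.

(** * Approximation by test functions *)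

Section approximation.
Context (R : realType) (n : nat) (n1 : (1 < n)%N).
Local Notation mu := (lebesgue_rV R n).
Variables (Omega : set 'rV[R]_n) (phi : 'rV[R]_n -> R) (G xi : 'rV[R]_n -> 'rV[R]_n).
Hypothesis oO : open Omega.
Hypothesis Ofin : (mu Omega < +oo)%E.
Hypothesis wG : weak_gradient Omega phi G.
Hypothesis xi_Lp : in_Lp_vec Omega (n%:R / (n%:R - 1))%:E xi.

Let mO : measurable Omega. Proof. exact: open_measurable_rV. Qed.

Let c1 := fine (mu Omega) `^ (1 - n%:R^-1).
Let X := \sum_i fine (Lp_norm Omega (n%:R / (n%:R - 1))%:E (fun x => xi x ord0 i)).

Let n1R : 1 < n%:R :> R. Proof. by rewrite ltr1n. Qed.

Let nconj : 1 < n%:R / (n%:R - 1) :> R.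
Proof. by rewrite ltr_pdivlMr ?subr_gt0// mul1r ltrBlDr ltrDl. Qed.

Lemma xi_integrable i : mu.-integrable Omega (EFin \o (fun x => xi x ord0 i)).
Proof.
have q1 : (1 <= (n%:R / (n%:R - 1) : R)%:E)%E by rewrite lee_fin ltW.
have [] := @holder_subset R n Omega Ofin _ _ Omega q1 (xi_Lp i) mO; first by [].
by [].
Qed.

(** The norm of F in L^n controls F in L^1 because Omega has finite measure, and the products
    F_i xi_i because n and n / (n - 1) are conjugate. *)
Lemma norm_lt_estimates eta F e : test_function Omega eta -> 0 <= e ->
  weak_gradient Omega (phi \- eta) F ->
  (W1p_norm Omega n%:R%:E (phi \- eta)%R F < e%:E)%E ->
  [/\ forall i, mu.-integrable Omega (EFin \o (fun x => F x ord0 i)),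
      forall i, mu.-integrable Omega (EFin \o (fun x => F x ord0 i * xi x ord0 i)) &
      mu.-integrable Omega (EFin \o (phi \- eta))] /\
  [/\ \int[mu]_(x in Omega) `|(phi \- eta) x| <= e * c1,
      \int[mu]_(x in Omega) (\sum_i `|F x ord0 i|) <= e * (n%:R * c1) &
      \int[mu]_(x in Omega) (\sum_i `|F x ord0 i * xi x ord0 i|) <= e * X].
Proof.
move=> te e0 wF Fe; have c10 : 0 <= c1 by exact: powR_ge0.
have [wF1 wF2 _] := wF; have [wG1 _ _] := wG.
have mphi := locally_Lebesgue_integrable_measurable oO wF1.
have mF i := locally_Lebesgue_integrable_measurable oO (wF2 i).
have nn1 : (1 <= (n%:R : R)%:E)%E by rewrite lee_fin ltW.
have N1 : (0 <= Lp_norm Omega n%:R%:E (phi \- eta)%R)%E by exact: Lnorm_ge0.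
have N2 : (0 <= Lp_norm Omega n%:R%:E (@euclid_norm R n \o F))%E by exact: Lnorm_ge0.
have [pL /andP[_ pe]] := in_Lp_of_norm_lt mO mphi (le_lt_trans (leeDl _ N2) Fe).
have mE := measurable_euclid_norm mF.
have [eL /andP[E0 ee]] := in_Lp_of_norm_lt mO mE (le_lt_trans (leeDr _ N1) Fe).
have [phi_i phi_le] := holder_subset Ofin nn1 pL mO (@subset_refl _ Omega).
have [E_i E_le] := holder_subset Ofin nn1 eL mO (@subset_refl _ Omega).
have FE x i : `|F x ord0 i| <= `|(@euclid_norm R n \o F) x|.
  by rewrite [leRHS]ger0_norm ?euclid_norm_ge0//; exact: coord_le_euclid_norm.
have iF i : mu.-integrable Omega (EFin \o (fun x => F x ord0 i)).
  apply: le_integrable E_i => //; first exact/measurable_EFinP.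
  by move=> x _; rewrite /= lee_fin FE.
have nn : (n%:R : R)^-1 + (n%:R / (n%:R - 1))^-1 = 1.
  rewrite invf_div; field; by rewrite gt_eqF// (lt_trans _ n1R).
have q0 : 0 < n%:R / (n%:R - 1) :> R by exact: lt_trans nconj.
have HP i := holder_product mO n1R nn q0 eL (xi_Lp i).
have mxi i := in_Lp_measurable mO (xi_Lp i).
have FxiE x i : `|F x ord0 i * xi x ord0 i| <=
    `|(@euclid_norm R n \o F) x * xi x ord0 i|.
  by rewrite !normrM ler_wpM2r.
have iFxi i : mu.-integrable Omega (EFin \o (fun x => F x ord0 i * xi x ord0 i)).
  apply: le_integrable (HP i).1 => //; first exact/measurable_EFinP/measurable_funM.
  by move=> x _; rewrite /= lee_fin FxiE.
have nV : fine ((n%:R : R)%:E)^-1%E = n%:R^-1.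
  by rewrite inver gt_eqF// (lt_trans _ n1R).
rewrite nV -/c1 in phi_le E_le.
split; first by split.
split.
- by apply: le_trans phi_le _; rewrite ler_wpM2r.
- rewrite Rintegral_sum_fun//; last by move=> i; exact: integrable_norm (iF i).
  apply: (@le_trans _ _ (\sum_(i < n) e * c1)); last first.
    by rewrite sumr_const card_ord mulrCA mulr_natl.
  apply: ler_sum => i _; apply: le_trans (ler_wpM2r c10 ee).
  apply: le_trans E_le; apply: le_Rintegral => //; exact: integrable_norm.
- rewrite Rintegral_sum_fun//; last by move=> i; exact: integrable_norm (iFxi i).
  rewrite mulr_sumr; apply: ler_sum => i _.
  apply: (@le_trans _ _ (fine (Lp_norm Omega n%:R%:E (@euclid_norm R n \o F)) *
     fine (Lp_norm Omega (n%:R / (n%:R - 1))%:E (fun x => xi x ord0 i)))); last first.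
    by rewrite ler_wpM2r// fine_ge0//; exact: Lnorm_ge0.
  apply: le_trans (HP i).2; apply: le_Rintegral mO _ _ _.
  - exact: integrable_norm (iFxi i).
  - exact: integrable_norm (HP i).1.
  - by move=> x _; exact: FxiE.
Qed.

Hypothesis phi0 : forall e : R, 0 < e -> exists2 eta, test_function Omega eta &
    exists2 F, weak_gradient Omega (phi \- eta) F &
      (W1p_norm Omega n%:R%:E (phi \- eta)%R F < e%:E)%E.

Lemma test_function_approximation (b : R) : 0 < b ->
  exists (eta : 'rV[R]_n -> R) (F : 'rV[R]_n -> 'rV[R]_n), [/\ test_function Omega eta,
      forall i, mu.-integrable Omega (EFin \o (fun x => F x ord0 i)),
      forall i, mu.-integrable Omega (EFin \o (fun x => F x ord0 i * xi x ord0 i)),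
      mu.-integrable Omega (EFin \o (phi \- eta)) &
      {ae mu, forall x, Omega x -> eta x != 0 ->
         forall i, G x ord0 i = F x ord0 i + partial i eta x}] /\
  [/\ \int[mu]_(x in Omega) `|(phi \- eta) x| <= b,
      \int[mu]_(x in Omega) (\sum_i `|F x ord0 i|) <= b &
      \int[mu]_(x in Omega) (\sum_i `|F x ord0 i * xi x ord0 i|) <= b].
Proof.
move=> b0; have c10 : 0 <= c1 by exact: powR_ge0.
have nc10 : 0 <= n%:R * c1 by rewrite mulr_ge0.
have X0 : 0 <= X by apply: sumr_ge0 => i _; rewrite fine_ge0//; exact: Lnorm_ge0.
have [e1 e10 H1] := small_factor c10 b0.
have [e2 e20 H2] := small_factor nc10 b0.
have [e3 e30 H3] := small_factor X0 b0.
pose e := Num.min e1 (Num.min e2 e3).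
have e0 : 0 < e by rewrite !lt_min e10 e20.
have [eta te [F wF Fe]] := phi0 e0.
have [[I1 I2 I3] [L1 L2 L3]] := norm_lt_estimates te (ltW e0) wF Fe.
exists eta, F; split; first by split => //; exact: weak_gradient_test wF te.
split.
- by apply: le_trans L1 _; apply: H1; rewrite ?(ltW e0)// ge_min lexx.
- by apply: le_trans L2 _; apply: H2; rewrite ?(ltW e0)// !ge_min lexx orbT.
- by apply: le_trans L3 _; apply: H3; rewrite ?(ltW e0)// !ge_min lexx !orbT.
Qed.

End approximation.

(** * Stampacchia's iteration *)

Section stampacchia.
Context (R : realType).

(** The ratio c < 1 with c^g = 2^-n: halving the gap between successive heights is exactly
    compensated by shrinking the measures by the factor c. *)
Definition level_ratio (n : nat) (g : R) : R := 2 `^ (- (n%:R / g)).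

Definition iteration_constant (n : nat) (g : R) : R :=
  (32 * n%:R) ^+ n * (2 / level_ratio n g) ^+ n.-1.

Lemma level_ratio_gt0 n g : 0 < level_ratio n g.
Proof. by rewrite powR_gt0. Qed.

Lemma level_ratio_powR n (g : R) : 0 < g -> level_ratio n g `^ g = (2 ^+ n)^-1.
Proof.
by move=> g0; rewrite -powRrM mulNr divfK ?gt_eqF// powRN powR_mulrn.
Qed.

Lemma level_ratio_lt1 n (g : R) : (0 < n)%N -> 0 < g -> level_ratio n g < 1.
Proof.
move=> n0 g0; rewrite /level_ratio powRN invf_lt1 ?powR_gt0//.
have e0 : 0 < n%:R / g by rewrite divr_gt0// ltr0n.
have : (1 : R) `^ (n%:R / g) < 2 `^ (n%:R / g).
  by apply: gt0_ltr_powR => //; rewrite ?nnegrE// ltr1n.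
by rewrite powR1.
Qed.

Lemma iteration_constant_ge0 n g : 0 <= iteration_constant n g.
Proof.
by rewrite mulr_ge0// exprn_ge0// ?mulr_ge0// invr_ge0 ltW// level_ratio_gt0.
Qed.

(** At the heights d (1 - 2^-j) the function f stays below y0 c^j, where c is the level
    ratio. In the decay inequality between consecutive heights, the factor 2^(-n j) from
    the gap cancels against (c^j)^g, so that a failure of the bound would contradict the
    lower bound on d^n independently of j. *)
Lemma stampacchia_iteration (n : nat) (f : R -> R) (g B y0 d : R) : (0 < n)%N ->
  0 < g -> 0 < y0 -> 0 < d ->
  (forall s t, s <= t -> f t <= f s) -> (forall s, 0 <= f s) ->
  (forall s t x y, 0 <= s -> s < t -> 0 < y -> f s < y -> 0 <= x -> x < f t ->
     ((t - s) / 4) ^+ n * x ^+ n.-1 <=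
     (4 * n%:R) ^+ n * (B * (y ^+ n.-1 * y `^ g))) ->
  f 0 < y0 -> iteration_constant n g * (B * y0 `^ g) < d ^+ n -> f d = 0.
Proof.
move=> n0 g0 y00 d0 fmono f0 decay f0y dn.
set c := level_ratio n g; have c0 : 0 < c := level_ratio_gt0 n g.
have key j : f (d * (1 - 2^-1 ^+ j)) < y0 * c ^+ j.
  elim: j => [|j IH]; first by rewrite !expr0 subrr mulr0 mulr1.
  rewrite ltNge; apply/negP => ley.
  set w : R := 2^-1 ^+ j in IH; set y : R := y0 * c ^+ j in IH.
  have w0 : 0 < w by rewrite exprn_gt0// invr_gt0.
  have w1 : w <= 1 by rewrite exprn_ile1// invf_le1// ler1n.
  have yp : 0 < y by rewrite mulr_gt0// exprn_gt0.
  have yg : y `^ g = y0 `^ g * w ^+ n.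
    rewrite /y powRM ?exprn_ge0// ?ltW//; congr (_ * _).
    rewrite -powR_mulrn ?ltW// powRAC level_ratio_powR// powR_mulrn ?invr_ge0//.
    by rewrite /w -exprVn -!exprM mulnC.
  have ce : y0 * c ^+ j.+1 = y * c by rewrite exprSr mulrA.
  rewrite ce in ley.
  (* Half of the bound to be refuted lies strictly below f at the next height. *)
  have H : ((d * (1 - 2^-1 ^+ j.+1) - d * (1 - w)) / 4) ^+ n * (y * c / 2) ^+ n.-1 <=
     (4 * n%:R) ^+ n * (B * (y ^+ n.-1 * y `^ g)).
    apply: decay => //.
    - by rewrite mulr_ge0 ?(ltW d0)// subr_ge0.
    - rewrite ltr_pM2l// ltrD2l ltrN2 exprS gtr_pMl// invf_lt1// ltr1n//.
    - by rewrite divr_ge0// mulr_ge0// ltW.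
    - have yc : 0 < y * c by exact: mulr_gt0.
      by apply: lt_le_trans ley; rewrite gtr_pMr// invf_lt1 ?ltr1n.
  have dE : (d * (1 - 2^-1 ^+ j.+1) - d * (1 - w)) / 4 = d / 8 * w.
    by rewrite exprS -/w; field.
  rewrite dE yg in H.
  have yn : 0 < y ^+ n.-1 by rewrite exprn_gt0.
  have wn : 0 < w ^+ n by rewrite exprn_gt0.
  have E1 : (d / 8 * w) ^+ n * (y * c / 2) ^+ n.-1 =
      d ^+ n * ((8^-1) ^+ n * (c / 2) ^+ n.-1) * (y ^+ n.-1 * w ^+ n).
    by rewrite -[y * c / 2]mulrA !exprMn; ring.
  have E2 : (4 * n%:R) ^+ n * (B * (y ^+ n.-1 * (y0 `^ g * w ^+ n))) =
      (4 * n%:R) ^+ n * (B * y0 `^ g) * (y ^+ n.-1 * w ^+ n) by ring.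
  rewrite E1 E2 ler_pM2r ?mulr_gt0// in H.
  have z0 : 0 < (8^-1 : R) ^+ n * (c / 2) ^+ n.-1.
    by rewrite mulr_gt0// exprn_gt0// ?divr_gt0.
  rewrite -ler_pdivlMr// in H.
  suff E3 : (4 * n%:R) ^+ n * (B * y0 `^ g) / (8^-1 ^+ n * (c / 2) ^+ n.-1) =
      iteration_constant n g * (B * y0 `^ g).
    by rewrite E3 leNgt dn in H.
  rewrite /iteration_constant -/c invfM -!exprVn invrK invf_div.
  rewrite (_ : (32 : R) * n%:R = 4 * n%:R * 8); last by ring.
  by rewrite [(_ * 8) ^+ n]exprMn; ring.
apply/eqP; rewrite eq_le f0 andbT leNgt; apply/negP => fd.
have c1 : `|c| < 1 by rewrite ger0_norm ?ltW// level_ratio_lt1.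
have fy : 0 < f d / y0 by rewrite divr_gt0.
have [j _ /(_ j (leqnn j))/= cj] := cvgr_lt _ (cvg_expr c1) _ fy.
have : f d <= f (d * (1 - 2^-1 ^+ j)).
  apply: fmono; rewrite ger_pMr// lerBlDr lerDl exprn_ge0// invr_ge0//.
rewrite leNgt => /negP; apply; apply: lt_trans (key j) _.
by rewrite mulrC -ltr_pdivlMr.
Qed.

End stampacchia.

(** * Decay of the distribution function *)

Lemma fine_measure_leU d (T : measurableType d) (R : realType)
    (mu : {measure set T -> \bar R}) (A B C : set T) :
  measurable A -> measurable B -> measurable C ->
  (mu B < +oo)%E -> (mu C < +oo)%E -> A `<=` B `|` C ->
  fine (mu A) <= fine (mu B) + fine (mu C).
Proof.
move=> mA mB mC Boo Coo ABC.
have Bf : mu B \is a fin_num by rewrite ge0_fin_numE.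
have Cf : mu C \is a fin_num by rewrite ge0_fin_numE.
have H : (mu A <= mu B + mu C)%E.
  apply: (@le_trans _ _ (mu (B `|` C))); last exact: measureU2.
  by apply: le_measure; rewrite ?inE//; exact: measurableU.
have Af : mu A \is a fin_num.
  by rewrite ge0_fin_numE// (le_lt_trans H)// lte_add_pinfty.
by rewrite -lee_fin EFinD !fineK.
Qed.

Lemma fine_inve_le1 (R : realType) (p : \bar R) : (1 <= p)%E ->
  0 <= fine p^-1%E <= 1.
Proof.
case: p => [p| |//]; last by rewrite invey/= lexx ler01.
rewrite lee_fin => p1; have p0 : 0 < p by exact: lt_le_trans p1.
by rewrite inver gt_eqF//= invr_ge0 (ltW p0) invf_le1.
Qed.

Lemma measurable_gt_set d (T : measurableType d) (R : realType) (D : set T)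
    (f : T -> R) (c : R) : measurable D -> measurable_fun D f ->
  measurable (D `&` [set x | c < f x]).
Proof.
move=> mD mf; rewrite (_ : [set x | c < f x] = f @^-1` [set` `]c, +oo[]).
  exact: mf.
by apply/seteqP; split => x /=; rewrite in_itv/= andbT.
Qed.

Lemma measurable_ge_set d (T : measurableType d) (R : realType) (D : set T)
    (f : T -> R) (c : R) : measurable D -> measurable_fun D f ->
  measurable (D `&` [set x | c <= f x]).
Proof.
move=> mD mf; rewrite (_ : [set x | c <= f x] = f @^-1` [set` `[c, +oo[]).
  exact: mf.
by apply/seteqP; split => x /=; rewrite in_itv/= andbT.
Qed.

(** The weights for which the three terms l k y^(1-sp), m a y^(1-sq) and v y of the level
    estimate all take the same value S. *)
Lemma optimal_weights (R : realType) (n : nat) (k a y sp sq : R) : (1 < n)%N ->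
  0 < k -> 0 < a -> 0 < y -> exists S : R,
  [/\ 0 < S, S ^+ n = k * a * y `^ (n%:R - sp - sq) &
    (S / (k * y `^ (1 - sp))) * (S / (a * y `^ (1 - sq))) * (S / y) ^+ (n - 2) = 1].
Proof.
move=> n1 k0 a0 y0; have n0 : n%:R != 0 :> R by rewrite pnatr_eq0 gtn_eqF// ltnW.
pose B : R := k * a * y `^ (n%:R - sp - sq).
have B0 : 0 < B by rewrite !mulr_gt0 ?powR_gt0.
exists (B `^ n%:R^-1).
have SB : (B `^ n%:R^-1) ^+ n = B.
  by rewrite -powR_mulrn ?powR_ge0// -powRrM mulVf// powRr1// ltW.
split; rewrite ?powR_gt0// expr_div_n.
move: (B `^ _) SB => S SB.
have y1 : y `^ (1 - sp) != 0 by rewrite gt_eqF ?powR_gt0.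
have y2 : y `^ (1 - sq) != 0 by rewrite gt_eqF ?powR_gt0.
have y3 : y ^+ (n - 2) != 0 by rewrite gt_eqF ?exprn_gt0.
have SE : S ^+ 2 * S ^+ (n - 2) = k * a * (y `^ (1 - sp) * y `^ (1 - sq) * y ^+ (n - 2)).
  rewrite -exprD subnKC// SB /B; congr (_ * _).
  rewrite -powR_mulrn ?ltW// -!powRD ?(gt_eqF y0) ?implybT//.
  congr (_ `^ _); rewrite natrB//; ring.
rewrite (_ : _ * _ = (S ^+ 2 * S ^+ (n - 2)) /
  (k * a * (y `^ (1 - sp) * y `^ (1 - sq) * y ^+ (n - 2)))).
  by rewrite SE divff// !mulf_neq0// gt_eqF.
by field; rewrite y1 y2 y3 !gt_eqF.
Qed.

(** Arithmetic of the level estimate: three terms of size S, and errors of size b so small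
    that together they count as a fourth. *)
Lemma level_sum_bound (R : realType) (n : nat) (N S m b f x y z w : R) :
  0 <= N -> 0 <= S -> 0 <= m -> b * (1 + N * m) <= N * S ->
  0 <= f <= b -> 0 <= x <= S -> 0 <= y <= b -> 0 <= m * z <= S -> 0 <= w <= S ->
  (f + N * (x + m * (y + z) + w)) ^+ n <= (4 * N * S) ^+ n.
Proof.
move=> N0 S0 m0 H /andP[f0 fb] /andP[x0 xS] /andP[y0 yb] /andP[z0 zS] /andP[w0 wS].
have my0 : 0 <= m * y by exact: mulr_ge0.
have I0 : 0 <= x + m * (y + z) + w by rewrite mulrDr !addr_ge0.
have myb : m * y <= m * b by rewrite ler_wpM2l.
apply: lerXn2r; rewrite ?nnegrE; first by rewrite addr_ge0 ?mulr_ge0.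
  by rewrite !mulr_ge0.
apply: le_trans (_ : b + N * (3 * S + m * b) <= _).
  by rewrite lerD// ler_wpM2l// mulrDr; lra.
rewrite (_ : b + _ = b * (1 + N * m) + 3 * (N * S)); last by ring.
by rewrite (_ : 4 * N * S = N * S + 3 * (N * S)) ?lerD2r//; ring.
Qed.

Section distribution_decay.
Context (R : realType) (n : nat) (n1 : (1 < n)%N).
Local Notation mu := (lebesgue_rV R n).
Variables (Omega : set 'rV[R]_n) (phi K A : 'rV[R]_n -> R).
Variables (G xi : 'rV[R]_n -> 'rV[R]_n) (p q : \bar R).
Hypothesis oO : open Omega.
Hypothesis Ofin : (mu Omega < +oo)%E.
Hypothesis wG : weak_gradient Omega phi G.
Hypothesis phi0 : forall e : R, 0 < e -> exists2 eta, test_function Omega eta &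
    exists2 F, weak_gradient Omega (phi \- eta) F &
      (W1p_norm Omega n%:R%:E (phi \- eta)%R F < e%:E)%E.
Hypothesis xi_Lp : in_Lp_vec Omega (n%:R / (n%:R - 1))%:E xi.
Hypothesis xi_div : weakly_div_free Omega xi.
Hypotheses (p1 : (1 <= p)%E) (q1 : (1 <= q)%E).
Hypothesis K_Lp : in_Lp Omega p K.
Hypothesis K0 : forall x, Omega x -> 0 <= K x.
Hypothesis A_Lp : in_Lp Omega q A.
Hypothesis A0 : forall x, Omega x -> 0 <= A x.
Hypothesis distortion : {ae mu, forall x, Omega x ->
  euclid_norm (G x) ^+ n <= K x * (dotv (G x) (xi x) + A x)}.

Definition distribution s := fine (mu (Omega `&` [set x | s < phi x])).

Let mO : measurable Omega. Proof. exact: open_measurable_rV. Qed.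

Let mphi : measurable_fun Omega phi.
Proof. by have [w _ _] := wG; exact: locally_Lebesgue_integrable_measurable w. Qed.

Let finite_sub B : B `<=` Omega -> (mu B < +oo)%E.
Proof. by move=> BO; apply: le_lt_trans Ofin; exact: le_outer_measure. Qed.

(** The level estimate for a test function eta close to phi, transferred to phi. Bounds y
    and x strictly above and below the two measures leave room for the exceptional set
    where eta is far from phi, so that no limit has to be taken. *)
Lemma distribution_decay s t k a x y : 0 <= s -> s < t ->
  fine (Lp_norm Omega p K) <= k -> 0 < k ->
  fine (Lp_norm Omega q A) <= a -> 0 < a ->
  0 < y -> distribution s < y -> 0 <= x -> x < distribution t ->
  ((t - s) / 4) ^+ n * x ^+ n.-1 <=
    (4 * n%:R) ^+ n * (k * a * y `^ (n%:R - fine p^-1%E - fine q^-1%E)).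
Proof.
move=> s0 st Kk k0 Aa a0 y0 sy x0 xt.
have n0 : 0 < n%:R :> R by rewrite ltr0n ltnW.
have [S [S0 SE lmv]] := optimal_weights (fine p^-1%E) (fine q^-1%E) n1 k0 a0 y0.
set yp : R := y `^ (1 - fine p^-1%E) in lmv.
set yq : R := y `^ (1 - fine q^-1%E) in lmv.
have yp0 : 0 < yp by exact: powR_gt0.
have yq0 : 0 < yq by exact: powR_gt0.
set l : R := S / (k * yp) in lmv; set m : R := S / (a * yq) in lmv.
set v : R := S / y in lmv.
have l0 : 0 < l by rewrite divr_gt0// mulr_gt0.
have m0 : 0 < m by rewrite divr_gt0// mulr_gt0.
have v0 : 0 < v by rewrite divr_gt0.
rewrite -SE -exprMn.
(* Both heights move inwards by h to absorb the difference of phi and eta, which leaves a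
   gap of 2 h between them. *)
set h : R := (t - s) / 4.
have h0 : 0 < h by rewrite divr_gt0// subr_gt0.
have sh0 : 0 <= s + h by rewrite addr_ge0// ltW.
have sht : s + h < t - h by rewrite /h; lra.
have th0 : 0 < t - h by exact: le_lt_trans sht.
have hV : 0 <= h^-1 by rewrite invr_ge0 ltW.
have nm0 : 0 <= 1 + n%:R * m by rewrite addr_ge0// mulr_ge0// ltW.
have nS0 : 0 < n%:R * S by exact: mulr_gt0.
have [b1 b10 H1] := small_factor nm0 nS0.
have sy' : 0 < y - distribution s by rewrite subr_gt0.
have xt' : 0 < distribution t - x by rewrite subr_gt0.
have [b2 b20 H2] := small_factor hV sy'.
have [b3 b30 H3] := small_factor hV xt'.
(* The size of the three approximation errors: b1 makes their contribution to the level
   estimate at most n S, b2 and b3 keep the exceptional set W within the room left by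
   y and x. *)
pose b := Num.min b1 (Num.min b2 b3).
have b0 : 0 < b by rewrite !lt_min b10 b20.
have {}H1 : b * (1 + n%:R * m) <= n%:R * S.
  by apply: H1; rewrite ?(ltW b0)// ge_min lexx.
have {}H2 : b * h^-1 <= y - distribution s.
  by apply: H2; rewrite ?(ltW b0)// !ge_min lexx orbT.
have {}H3 : b * h^-1 <= distribution t - x.
  by apply: H3; rewrite ?(ltW b0)// !ge_min lexx !orbT.
have [eta [F [[te F_i Fxi_i d_i GF] [dB FB FxiB]]]] :=
  test_function_approximation n1 oO Ofin wG xi_Lp phi0 b0.
have [se _ _] := te.
have meta : measurable_fun Omega eta.
  exact/measurable_funTS/continuous_measurable_rV/smooth_continuous.
(* Off W, heights of phi and eta differ by less than h. *)
set W := Omega `&` [set x | h <= `|(phi \- eta) x|].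
have mW : measurable W.
  have md : measurable_fun Omega (fun x => `|(phi \- eta) x|).
    by apply: measurableT_comp => //; exact: measurable_funB.
  exact: (measurable_ge_set h mO md).
have Wb : fine (mu W) <= b * h^-1.
  by apply: le_trans (chebyshev mO Ofin h0 d_i) _; rewrite ler_wpM2r.
set U := Omega `&` [set x | s + h < eta x].
have mU : measurable U by exact: measurable_gt_set.
have UO : U `<=` Omega by move=> z [].
have Uy : fine (mu U) <= y.
  apply: (@le_trans _ _ (distribution s + fine (mu W))); last by lra.
  apply: fine_measure_leU => //.
  - exact: measurable_gt_set.
  - by apply: finite_sub => z [].
  - by apply: finite_sub => z [].
  - move=> z [Oz /= sz]; have [hz|hz] := leP h `|(phi \- eta) z|; [right|left].
      by split.
    by split => //=; move: hz; rewrite ltr_norml/= => /andP[]; lra.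
set E := [set z | t - h <= eta z].
have EO : E `<=` Omega.
  move=> z /= tz; have [_ _ sO] := te; apply: sO; apply: subset_closure => /=.
  by rewrite gt_eqF// (lt_le_trans th0).
have mE : measurable E.
  by have := measurable_ge_set (t - h) mO meta; rewrite (setIidr EO).
have xE : x <= fine (mu E).
  apply: (@le_trans _ _ (distribution t - fine (mu W))); first by lra.
  rewrite lerBlDr; apply: fine_measure_leU => //.
  - exact: measurable_gt_set.
  - exact: finite_sub.
  - by apply: finite_sub => z [].
  - move=> z [Oz /= tz]; have [hz|hz] := leP h `|(phi \- eta) z|; [right|left].
      by split.
    by rewrite /E/=; move: hz; rewrite ltr_norml/= => /andP[]; lra.
have [K_i _] := holder_subset Ofin p1 K_Lp mO (@subset_refl _ Omega).
have [A_i _] := holder_subset Ofin q1 A_Lp mO (@subset_refl _ Omega).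
have [_ KU] := holder_subset Ofin p1 K_Lp mU UO.
have [_ AU] := holder_subset Ofin q1 A_Lp mU UO.
have := level_estimate n1 mO Ofin te (xi_integrable n1 oO Ofin xi_Lp) xi_div K_i K0
  A_i A0 F_i Fxi_i distortion GF l0 m0 v0 lmv sh0 sht.
rewrite (_ : (t - h - (s + h)) / 2 = h); last by rewrite /h; field.
rewrite -/U -/E => H.
apply: (@le_trans _ _ (h ^+ n * fine (mu E) ^+ n.-1)).
  rewrite ler_pM2l ?exprn_gt0// lerXn2r// ?nnegrE//; exact: le_trans xE.
apply: (le_trans H).
have powU (r : \bar R) : (1 <= r)%E ->
    fine (mu U) `^ (1 - fine r^-1%E) <= y `^ (1 - fine r^-1%E).
  move=> r1; apply: ge0_ler_powR => //; rewrite ?nnegrE ?fine_ge0// ?(ltW y0)//.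
  by rewrite subr_ge0; case/andP: (fine_inve_le1 r1).
have KU' : l * \int[mu]_(z in U) K z <= S.
  rewrite /l mulrAC ler_pdivrMr ?mulr_gt0// ler_pM2l//.
  apply: (@le_trans _ _ (\int[mu]_(z in U) `|K z|)).
    apply: le_trans (ler_norm _) _; apply: le_normr_Rintegral => //.
    exact: integrableS K_i.
  apply: le_trans KU _; apply: ler_pM => //; last exact: powU.
    by rewrite fine_ge0//; exact: Lnorm_ge0.
have AU' : m * \int[mu]_(z in U) A z <= S.
  rewrite /m mulrAC ler_pdivrMr ?mulr_gt0// ler_pM2l//.
  apply: (@le_trans _ _ (\int[mu]_(z in U) `|A z|)).
    apply: le_trans (ler_norm _) _; apply: le_normr_Rintegral => //.
    exact: integrableS A_i.
  apply: le_trans AU _; apply: ler_pM => //; last exact: powU.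
    by rewrite fine_ge0//; exact: Lnorm_ge0.
have vU' : v * fine (mu U) <= S.
  by rewrite /v mulrAC ler_pdivrMr// ler_pM2l.
have int0 (f : 'rV[R]_n -> R) : (forall z, 0 <= f z) ->
    0 <= \int[mu]_(z in Omega) f z by move=> f0; apply: Rintegral_ge0.
have int0U (f : 'rV[R]_n -> R) : (forall z, Omega z -> 0 <= f z) ->
    0 <= \int[mu]_(z in U) f z.
  by move=> f0; apply: Rintegral_ge0 => z /UO; exact: f0.
have U0 : 0 <= fine (mu U) by exact: fine_ge0.
have FB0 : 0 <= \int[mu]_(z in Omega) (\sum_i `|F z ord0 i|).
  by apply: int0 => z; exact: sumr_ge0.
have FxiB0 : 0 <= \int[mu]_(z in Omega) (\sum_i `|F z ord0 i * xi z ord0 i|).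
  by apply: int0 => z; exact: sumr_ge0.
have KU0 := int0U _ K0; have AU0 := int0U _ A0.
have lKU0 := mulr_ge0 (ltW l0) KU0; have mAU0 := mulr_ge0 (ltW m0) AU0.
have vU0 := mulr_ge0 (ltW v0) U0.
apply: (level_sum_bound n (ltW n0) (ltW S0) (ltW m0) H1); exact/andP.
Qed.

Lemma ae_le_of_distribution0 d : distribution d = 0 ->
  {ae mu, forall x, Omega x -> phi x <= d}.
Proof.
move=> d0; exists (Omega `&` [set x | d < phi x]); split.
- exact: measurable_gt_set.
- set W := Omega `&` _.
  have Wlt : (mu W < +oo)%E.
    by apply: le_lt_trans Ofin; apply: le_outer_measure => x [].
  have Wfin : mu W \is a fin_num by rewrite ge0_fin_numE.
  by rewrite -(fineK Wfin); congr EFin.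
- move=> x /= /not_implyP[Ox /negP]; rewrite -ltNge => dx; by split.
Qed.

Let fine_measure_le B C : measurable B -> measurable C -> B `<=` C ->
  C `<=` Omega -> fine (mu B) <= fine (mu C).
Proof.
move=> mB mC BC CO; apply: fine_le; rewrite ?ge0_fin_numE//; try exact: finite_sub.
  by apply: finite_sub; exact: subset_trans CO.
by apply: le_measure; rewrite ?inE.
Qed.

Lemma distribution_nonincreasing s t : s <= t -> distribution t <= distribution s.
Proof.
move=> st; apply: fine_measure_le; try exact: measurable_gt_set; last by move=> z [].
by move=> z [Oz /= tz]; split => //=; exact: le_lt_trans tz.
Qed.

(** The iteration starts from y0 = 2 |Omega| in order to have a strict inequality at
    height 0. *)
Lemma essential_upper_bound k a d :
  0 < 1 - fine p^-1%E - fine q^-1%E ->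
  fine (Lp_norm Omega p K) <= k -> 0 < k ->
  fine (Lp_norm Omega q A) <= a -> 0 < a -> 0 < d ->
  iteration_constant n (1 - fine p^-1%E - fine q^-1%E) *
    (k * a * (2 * fine (mu Omega)) `^ (1 - fine p^-1%E - fine q^-1%E)) < d ^+ n ->
  {ae mu, forall x, Omega x -> phi x <= d}.
Proof.
set g : R := 1 - _ - _ => g0 Kk k0 Aa a0 d0 dn.
have Of : mu Omega \is a fin_num by rewrite ge0_fin_numE.
have [m0|m0] := eqVneq (fine (mu Omega)) 0.
  exists Omega; split => //; first by rewrite -(fineK Of) m0.
  by move=> x /= /not_implyP[].
have {}m0 : 0 < fine (mu Omega) by rewrite lt_def m0 fine_ge0.
apply: ae_le_of_distribution0.
apply: (@stampacchia_iteration R n distribution g (k * a) (2 * fine (mu Omega))) => //.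
- exact: ltnW.
- exact: mulr_gt0.
- exact: distribution_nonincreasing.
- by move=> s; exact: fine_ge0.
- move=> s t x y s0 st y0 sy x0 xt.
  have <- : y `^ (n%:R - fine p^-1%E - fine q^-1%E) = y ^+ n.-1 * y `^ g.
    rewrite -powR_mulrn ?ltW// -powRD ?(gt_eqF y0) ?implybT//; congr (_ `^ _).
    by rewrite /g -[in LHS](prednK (ltnW n1)) -natr1; ring.
  exact: (distribution_decay s0 st Kk k0 Aa a0 y0 sy x0 xt).
- apply: (@le_lt_trans _ _ (fine (mu Omega))); last by rewrite mulr_natl mulr2n ltrDl.
  by apply: fine_measure_le => //; exact: measurable_gt_set.
Qed.

End distribution_decay.

(** * Change of sign *)

Section opposite.
Context (R : realType) (n : nat).
Local Notation mu := (lebesgue_rV R n).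
Variable Omega : set 'rV[R]_n.
Implicit Types (u eta : 'rV[R]_n -> R) (F xi : 'rV[R]_n -> 'rV[R]_n).

Lemma partialN eta i : (forall x, derivable eta x (delta_mx ord0 i)) ->
  partial i (\- eta) = \- partial i eta.
Proof. by move=> d; apply/funext => x; rewrite /partial deriveN. Qed.

Lemma test_functionN eta : test_function Omega eta -> test_function Omega (\- eta).
Proof.
move=> [se ce sO].
have supE : [set x | (\- eta) x != 0] = [set x | eta x != 0].
  by apply/seteqP; split => x /=; rewrite oppr_eq0.
have fE s : foldr (@partial R n) (\- eta) s = \- foldr (@partial R n) eta s.
  by elim: s => [//|i s IH] /=; rewrite IH partialN//; exact: (se s).2.
split; rewrite ?supE// => s; rewrite fE; have [cs ds] := se s.
split; first by move=> x; apply: continuousN; exact: cs.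
by move=> i x; apply: derivableN; exact: ds.
Qed.

(** Both integrals are those of the identity for u tested with - eta. *)
Lemma weak_gradientN u F : weak_gradient Omega u F ->
  weak_gradient Omega (\- u) (\- F).
Proof.
move=> [iu iF wF]; split.
- by move=> D cD DO; exact: (integrableN (iu D cD DO)).
- move=> i D cD DO; have := integrableN (iF i D cD DO).
  by under [in X in _ -> X]eq_fun do rewrite /= mxE.
- move=> eta te i; have := wF _ (test_functionN te) i.
  have [se _ _] := te.
  rewrite partialN; last by move=> x; exact: (se [::]).2.
  rewrite (@eq_Rintegral _ _ _ mu Omega (fun x => (\- u) x * partial i eta x)); last first.
    by move=> x _ /=; rewrite mulrN mulNr.
  move=> ->; congr (- _); apply: eq_Rintegral => x _.
  by rewrite /= mxE mulrN mulNr.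
Qed.

Lemma weakly_div_freeN xi : weakly_div_free Omega xi -> weakly_div_free Omega (\- xi).
Proof.
move=> div eta te; rewrite -[RHS](div _ (test_functionN te)).
have [se _ _] := te; apply: eq_Rintegral => x _; apply: eq_bigr => i _.
rewrite !mxE partialN/= ?mulrN ?mulNr// => y; exact: (se [::]).2.
Qed.

Lemma Lp_normN p u : Lp_norm Omega p (\- u) = Lp_norm Omega p u.
Proof.
rewrite /Lp_norm -oppe_Lnorm; congr Lnorm; apply/funext => x /=.
by rewrite /patch; case: ifPn => _; rewrite /= ?opprK ?oppr0.
Qed.

Lemma in_LpN p u : in_Lp Omega p u -> in_Lp Omega p (\- u).
Proof.
rewrite /in_Lp => up; rewrite (_ : _ \_ _ = - (u \_ Omega)) ?rpredN//.
by apply/funext => x; rewrite /patch /= fctE; case: ifPn => _; rewrite ?oppr0.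
Qed.

Lemma dotvNN (x y : 'rV[R]_n) : dotv (- x) (- y) = dotv x y.
Proof. by apply: eq_bigr => i _; rewrite !mxE mulrNN. Qed.

Lemma euclid_normN (x : 'rV[R]_n) : euclid_norm (- x) = euclid_norm x.
Proof. by rewrite /euclid_norm dotvNN. Qed.

Lemma W1p_normN p u F : W1p_norm Omega p (\- u) (\- F) = W1p_norm Omega p u F.
Proof.
rewrite /W1p_norm Lp_normN; congr (_ + Lp_norm _ _ _)%E.
by apply/funext => x /=; rewrite euclid_normN.
Qed.

Lemma le_Lnorm_infty u (d : R) :
  0 <= d -> {ae mu, forall x, Omega x -> u x <= d} ->
  {ae mu, forall x, Omega x -> (\- u) x <= d} ->
  (Lp_norm Omega +oo u <= d%:E)%E.
Proof.
move=> d0 ud nd; rewrite /Lp_norm unlock; case: ifP => _; last by rewrite lee_fin.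
apply/ess_supP; apply: filterS2 ud nd => x ud nd /=.
rewrite lee_fin /patch; case: ifPn => [|_]; last by rewrite normr0.
by rewrite inE => Ox; rewrite ler_norml lerNl nd// ud.
Qed.

End opposite.

(** * The sup norm estimate *)

Lemma inve_EFin (R : realType) (p : \bar R) : (1 <= p)%E ->
  p^-1%E = (fine p^-1%E)%:E.
Proof.
case: p => [p| |//]; last by rewrite invey.
by rewrite lee_fin => p1; rewrite inver gt_eqF// (lt_le_trans _ p1).
Qed.

Lemma essential_bound (R : realType) (n : nat) (n1 : (1 < n)%N)
    (Omega : set 'rV[R]_n) (phi K A : 'rV[R]_n -> R) (G xi : 'rV[R]_n -> 'rV[R]_n)
    (p q : \bar R) (k a d : R) :
  open Omega -> (lebesgue_rV R n Omega < +oo)%E ->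
  weak_gradient Omega phi G -> W1p0 Omega n%:R%:E phi ->
  in_Lp_vec Omega (n%:R / (n%:R - 1))%:E xi -> weakly_div_free Omega xi ->
  (1 <= p)%E -> (1 <= q)%E -> in_Lp Omega p K -> (forall x, Omega x -> 0 <= K x) ->
  in_Lp Omega q A -> (forall x, Omega x -> 0 <= A x) ->
  {ae lebesgue_rV R n, forall x, Omega x ->
    euclid_norm (G x) ^+ n <= K x * (dotv (G x) (xi x) + A x)} ->
  0 < 1 - fine p^-1%E - fine q^-1%E ->
  fine (Lp_norm Omega p K) <= k -> 0 < k ->
  fine (Lp_norm Omega q A) <= a -> 0 < a -> 0 < d ->
  iteration_constant n (1 - fine p^-1%E - fine q^-1%E) *
    (k * a * (2 * fine (lebesgue_rV R n Omega)) `^ (1 - fine p^-1%E - fine q^-1%E))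
    < d ^+ n ->
  (Lp_norm Omega +oo phi <= d%:E)%E.
Proof.
move=> oO Ofin wG [_ phi0] xi_Lp xi_div p1 q1 K_Lp K0 A_Lp A0 dis g0 Kk k0 Aa a0 d0 dn.
apply: le_Lnorm_infty (ltW d0) _ _.
  exact: (essential_upper_bound n1 oO Ofin wG phi0 xi_Lp xi_div p1 q1 K_Lp K0
    A_Lp A0 dis g0 Kk k0 Aa a0 d0 dn).
have phiN0 e : 0 < e -> exists2 eta, test_function Omega eta &
    exists2 F, weak_gradient Omega ((\- phi) \- eta) F &
      (W1p_norm Omega n%:R%:E ((\- phi) \- eta)%R F < e%:E)%E.
  move=> /phi0[eta te [F wF Fe]]; exists (\- eta); first exact: test_functionN.
  have E : (\- phi) \- (\- eta) = \- (phi \- eta).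
    by apply/funext => x /=; rewrite opprB opprK addrC.
  by exists (\- F); rewrite E; [exact: weak_gradientN|rewrite W1p_normN].
have disN : {ae lebesgue_rV R n, forall x, Omega x ->
    euclid_norm ((\- G) x) ^+ n <= K x * (dotv ((\- G) x) ((\- xi) x) + A x)}.
  by apply: filterS dis => x H Ox; rewrite /= euclid_normN dotvNN; exact: H.
have xi_LpN : in_Lp_vec Omega (n%:R / (n%:R - 1))%:E (\- xi).
  move=> i; have := in_LpN (xi_Lp i).
  by rewrite (_ : (\- _) = (fun x => (\- xi) x ord0 i))//; apply/funext => x; rewrite /= mxE.
exact: (essential_upper_bound n1 oO Ofin (weak_gradientN wG) phiN0 xi_LpN
  (weakly_div_freeN xi_div) p1 q1 K_Lp K0 A_Lp A0 disN g0 Kk k0 Aa a0 d0 dn).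
Qed.

Theorem theorem1p6 (R : realType) (n : nat) (hn : (2 <= n)%N) (p q : \bar R)
    (hp : (1 <= p)%E) (hq : (1 <= q)%E) (hpq : (p^-1 + q^-1 < 1)%E) :
  exists C : R,
  forall (Omega : set 'rV[R]_n) (phi : 'rV[R]_n -> R)
    (grad_phi : 'rV[R]_n -> 'rV[R]_n) (K A : 'rV[R]_n -> R)
    (xi : 'rV[R]_n -> 'rV[R]_n),
  open Omega -> bounded_set Omega ->
  W1p0 Omega (n%:R)%:E phi -> weak_gradient Omega phi grad_phi ->
  measurable_fun Omega K -> (forall x, Omega x -> 0 <= K x) ->
  measurable_fun Omega A -> (forall x, Omega x -> 0 <= A x) ->
  in_Lp_vec Omega (n%:R / (n%:R - 1))%:E xi -> weakly_div_free Omega xi ->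
  {ae lebesgue_rV R n, forall x, Omega x ->
    euclid_norm (grad_phi x) ^+ n <=
      K x * (dotv (grad_phi x) (xi x) + A x)} ->
  in_Lp Omega p K -> in_Lp Omega q A ->
  (Lp_norm Omega +oo phi ^+ n <=
    C%:E * Lp_norm Omega p K * Lp_norm Omega q A *
      (lebesgue_rV R n Omega) `^ (fine (1 - p^-1 - q^-1)))%E.
Proof.
have pE := inve_EFin hp; have qE := inve_EFin hq.
pose g : R := 1 - fine p^-1%E - fine q^-1%E.
have gE : fine (1 - p^-1 - q^-1)%E = g by rewrite pE qE.
have g0 : 0 < g.
  by move: hpq; rewrite pE qE -EFinD lte_fin /g -addrA -opprD subr_gt0.
exists (iteration_constant n g * 2 `^ g).
move=> Omega phi G K A xi oO bO phi0 wG mK K0 mA A0 xi_Lp xi_div dis K_Lp A_Lp.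
rewrite gE; set mu := lebesgue_rV R n.
have Ofin : (mu Omega < +oo)%E by exact: bounded_lebesgue_rV_lty.
have finO : mu Omega \is a fin_num by rewrite ge0_fin_numE.
have fin_norm (r : \bar R) f : in_Lp Omega r f -> Lp_norm Omega r f \is a fin_num.
  by move=> /andP[_]; rewrite inE/= => h; rewrite ge0_fin_numE//; exact: Lnorm_ge0.
pose kn : R := fine (Lp_norm Omega p K); pose an : R := fine (Lp_norm Omega q A).
have kn0 : 0 <= kn by rewrite fine_ge0//; exact: Lnorm_ge0.
have an0 : 0 <= an by rewrite fine_ge0//; exact: Lnorm_ge0.
(* The factor 2^g comes from the starting bound 2 |Omega| of the iteration. *)
pose Q : R := iteration_constant n g * 2 `^ g * fine (mu Omega) `^ g.
have Q0 : 0 <= Q by exact: mulr_ge0 (mulr_ge0 (iteration_constant_ge0 _ _) (powR_ge0 _ _)) (powR_ge0 _ _).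
have n0 : n%:R != 0 :> R by rewrite pnatr_eq0 gtn_eqF// ltnW.
have QM0 e : 0 < e -> 0 <= Q * ((kn + e) * (an + e)).
  by move=> e0; apply: mulr_ge0 Q0 _; rewrite mulr_ge0// addr_ge0// ltW.
(* The norms of K and A may vanish, whereas [essential_bound] needs positive bounds and a
   strict inequality for d; all are perturbed by e. *)
have bound e : 0 < e ->
    (Lp_norm Omega +oo phi <=
      ((Q * ((kn + e) * (an + e)) + e) `^ n%:R^-1)%:E)%E.
  move=> e0; set M : R := Q * _ + e.
  have M0 : 0 < M by rewrite ltr_wpDl// QM0.
  have dE : (M `^ n%:R^-1) ^+ n = M.
    by rewrite -powR_mulrn ?powR_ge0// -powRrM mulVf// powRr1// ltW.
  apply: (@essential_bound R n hn Omega phi K A G xi p q (kn + e) (an + e)) => //.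
  - by rewrite lerDl ltW.
  - by rewrite ltr_wpDl.
  - by rewrite lerDl ltW.
  - by rewrite ltr_wpDl.
  - by rewrite powR_gt0.
  - rewrite dE -/g powRM ?fine_ge0//.
    rewrite (_ : _ * _ = Q * ((kn + e) * (an + e))); last by rewrite /Q; ring.
    by rewrite /M ltrDl.
have Nfin : Lp_norm Omega +oo phi \is a fin_num.
  by rewrite ge0_fin_numE ?Lnorm_ge0// (le_lt_trans (bound 1 ltr01)) ?ltry.
have N0 : 0 <= fine (Lp_norm Omega +oo phi) by rewrite fine_ge0//; exact: Lnorm_ge0.
rewrite -(fineK Nfin) -(fineK (fin_norm _ _ K_Lp)) -(fineK (fin_norm _ _ A_Lp)).
rewrite -(fineK finO) poweR_EFin -!EFinM -EFin_expe lee_fin -/kn -/an.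
rewrite [leRHS](_ : _ = Q * (kn * an)); last by rewrite /Q; ring.
apply/ler_addgt0Pr => b b0.
have c0 : 0 <= Q * (kn + an + 1) + 1 by rewrite addr_ge0// mulr_ge0// !addr_ge0.
have [e0 e00 He] := small_factor c0 b0.
pose e : R := Num.min e0 1; have ep : 0 < e by rewrite lt_min e00 ltr01.
have e1 : e <= 1 by rewrite ge_min lexx orbT.
have {}He : e * (Q * (kn + an + 1) + 1) <= b.
  by apply: He; rewrite ?(ltW ep)// ge_min lexx.
have M0 : 0 <= Q * ((kn + e) * (an + e)) + e.
  by rewrite addr_ge0 ?QM0// ltW.
apply: (@le_trans _ _ (Q * ((kn + e) * (an + e)) + e)).
  have := bound e ep; rewrite -(fineK Nfin) lee_fin => H.
  apply: le_trans (lerXn2r n _ _ H) _; rewrite ?nnegrE ?powR_ge0//.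
  by rewrite -powR_mulrn ?powR_ge0// -powRrM mulVf// powRr1.
have ee : Q * (e * e) <= Q * e by rewrite ler_wpM2l// ler_piMl// ltW.
have -> : Q * ((kn + e) * (an + e)) + e =
  Q * (kn * an) + (e * (Q * (kn + an)) + Q * (e * e) + e) by ring.
rewrite lerD2l; apply: le_trans He.
rewrite (_ : e * (_ + 1) = e * (Q * (kn + an)) + Q * e + e); last by ring.
by rewrite lerD2r lerD2l.
Qed.
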